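(* Let $0<\alpha<1$, let $\Omega\subset\mathbb R^2$ be a smooth bounded domain satisfying the geometric conditions (G1) and (G2) of the context, let $(u_p)$ be a family of least-energy solutions, and let $p_n\to+\infty$, $x_\infty$, $x_n$, $\varepsilon_n$ be a concentrating sequence as fixed in the context. Let $(\lambda_{1,n},\phi_{1,n})$ be the first eigenpair of the linearized problem at $u_{p_n}$ described in the context, with the principal eigenfunction $\phi_{1,n}$ chosen positive, and define $$\varphi_n(\xi):=\frac{\phi_{1,n}(x_n+\varepsilon_n\xi)}{\phi_{1,n}(x_n)},\qquad \xi\in\Omega_n:=\frac{\Omega-x_n}{\varepsilon_n}.$$ Then, as $n\to\infty$, $$\lambda_{1,n}=\frac{1}{2p_n+1},\qquad \phi_{1,n}=\frac{u_{p_n}}{\|u_{p_n}\|_{L^\infty(\Omega)}},\qquad \varphi_n\to1\quad\text{in } C^1_{\mathrm{loc}}(\mathbb R^2)$$ (the first two being exact identities).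
   Context: Problem. For $0<\alpha<1$, a smooth bounded domain $\Omega\subset\mathbb R^2$ and $p>1$, problem $(P_p)$ is: $-\Delta u=\left(\int_\Omega\frac{u^{p+1}(y)}{|x-y|^\alpha}dy\right)u^p$ in $\Omega$, $u>0$ in $\Omega$, $u=0$ on $\partial\Omega$. Its energy is $\mathcal E_p(v)=\frac12\int_\Omega|\nabla v|^2dx-\frac1{2(p+1)}\int_\Omega\int_\Omega\frac{|v(x)|^{p+1}|v(y)|^{p+1}}{|x-y|^\alpha}dxdy$ and its Nehari manifold is $\mathcal N_p=\{v\in H_0^1(\Omega)\setminus\{0\}:\langle\mathcal E_p'(v),v\rangle=0\}$. A least-energy solution is a solution of $(P_p)$ that minimizes $\mathcal E_p$ on $\mathcal N_p$. Geometric conditions. (G1): $R_\Omega:=\sup\{\rho: B_\rho(x)\subset\Omega\text{ for some }x\in\Omega\}$ satisfies $R_\Omega\ge\left(\frac{2(4-\alpha)\pi}{\tilde C_\alpha}\right)^{1/(4-\alpha)}$, where $\tilde C_\alpha=\int_{B_1(0)}\int_{B_1(0)}\frac{dxdy}{|x-y|^\alpha}$. (G2): there is $y\in\Omega$ with $\langle x-y,\nu(x)\rangle>0$ for all $x\in\partial\Omega$ ($\nu$ the unit outer normal) and $\int_{\partial\Omega}\frac{1}{\langle x-y,\nu(x)\rangle}d\sigma_x<2\pi e$. Green and Robin functions. $G(x,y)$ is the Dirichlet Green function of $-\Delta$ in $\Omega$ ($-\Delta G(\cdot,y)=\delta_y$, $G(\cdot,y)=0$ on $\partial\Omega$), $H(x,y)=-\frac1{2\pi}\log|x-y|-G(x,y)$,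 and $R(x)=H(x,x)$ is the Robin function. Concentrating sequence. Assume (G1), (G2) and let $(u_p)$ be a family of least-energy solutions of $(P_p)$. It is known that there are $x_\infty\in\Omega$ and $p_n\to+\infty$ such that, with $x_n$ a global maximum point of $u_{p_n}$, the following hold; such data are fixed: (i) $\sqrt{p_n}\,u_{p_n}\to0$ in $C^1_{\mathrm{loc}}(\overline\Omega\setminus\{x_\infty\})$ and $p_nu_{p_n}\to2(4-\alpha)\pi\sqrt e\,G(\cdot,x_\infty)$ in $C^2_{\mathrm{loc}}(\overline\Omega\setminus\{x_\infty\})$; (ii) $p_n\int_\Omega|\nabla u_{p_n}|^2dx\to2(4-\alpha)\pi e$; (iii) $\nabla R(x_\infty)=0$; (iv) $x_n\to x_\infty$ and $u_{p_n}(x_n)=\|u_{p_n}\|_{L^\infty(\Omega)}\to\sqrt e$; (v) with $\varepsilon_n:=\left(p_nu_{p_n}^{2p_n}(x_n)\right)^{-1/(4-\alpha)}$, $\Omega_n:=\frac{\Omega-x_n}{\varepsilon_n}$ and $v_n(x):=\frac{p_n}{u_{p_n}(x_n)}\left(u_{p_n}(\varepsilon_nx+x_n)-u_{p_n}(x_n)\right)$ for $x\in\Omega_n$, one has $\varepsilon_n\to0$ and $v_n\to U$ in $C^2_{\mathrm{loc}}(\mathbb R^2)$, where $U(x)=-\frac{4-\alpha}2\log(1+C_\alpha^{-2}|x|^2)$, $C_\alpha=\left(\frac{(2-\alpha)(4-\alpha)}{\pi}\right)^{1/(4-\alpha)}$, which solves $-\Delta U=\left(\int_{\mathbb R^2}\frac{e^{U(y)}}{|x-y|^\alpha}dy\right)e^{U}$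 in $\mathbb R^2$. Linearized problem. $\lambda_{1,n}\le\lambda_{2,n}\le\cdots$ (counted with multiplicity) and $\phi_{i,n}$ are the eigenvalues and eigenfunctions of $-\Delta\phi=\lambda\left(p_nu_{p_n}^{p_n-1}\phi\int_\Omega\frac{u_{p_n}^{p_n+1}(y)}{|x-y|^\alpha}dy+(p_n+1)u_{p_n}^{p_n}\int_\Omega\frac{u_{p_n}^{p_n}(y)\phi(y)}{|x-y|^\alpha}dy\right)$ in $\Omega$, $\phi=0$ on $\partial\Omega$, normalized by $\|\phi\|_{L^\infty(\Omega)}=1$. *)

(* Defs.v *)
From HB Require Import structures.
From mathcomp Require Import all_boot all_order all_algebra.
From mathcomp Require Import all_classical all_reals all_analysis.

Set Implicit Arguments.
Unset Strict Implicit.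
Unset Printing Implicit Defensive.

Import Order.TTheory GRing.Theory Num.Theory.
Import numFieldNormedType.Exports.
Local Open Scope classical_set_scope.
Local Open Scope ring_scope.

(* [R * R] carries the library's product topology (sup norm), which is the
   usual one; every metric quantity below uses the Euclidean norm [enorm]. *)
Notation plane R := (R * R)%type (only parsing).

Section Plane.
Context {R : realType}.
Implicit Types (x y z : plane R) (f g : plane R -> R) (A D K : set (plane R)).

Definition dot x y : R := x.1 * y.1 + x.2 * y.2.
Definition enorm x : R := Num.sqrt (dot x x).
Definition disk x (r : R) : set (plane R) := [set y | enorm (y - x) < r].

(* [measurableTypeR R] is R with the Borel sigma-algebra under which the
   library states [lebesgue_measure] *)
Definition mplane := (measurableTypeR R * measurableTypeR R)%type.

Definition leb2 : {measure set mplane -> \bar R} :=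
  (@lebesgue_measure R \x @lebesgue_measure R)%E.

Definition evec (i : 'I_2) : plane R := if i == ord0 then (1, 0) else (0, 1).
Definition pd (i : 'I_2) f : plane R -> R := fun x => 'D_(evec i) f x.
Definition pds (s : seq 'I_2) f : plane R -> R := foldr pd f s.
Definition grad f x : plane R := (pd ord0 f x, pd ord_max f x).
Definition laplacian f x : R := \sum_(i < 2) pds [:: i; i] f x.

(* only meaningful for D open, as [pds] differentiates the total function *)
Definition Ck (k : nat) D f : Prop :=
  (forall s x, (size s <= k)%N -> D x -> {for x, continuous (pds s f)}) /\
  (forall s i x, (size s < k)%N -> D x -> derivable (pds s f) x (evec i)).

Definition smooth_on D f : Prop := forall k, Ck k D f.

(* C^k(E) for D open and D `<=` E `<=` closure D: the derivatives computed in
   D extend continuously to E *)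
Definition Ck_upto (k : nat) D (E : set (plane R)) f : Prop :=
  Ck k D f /\
  (forall s, (size s <= k)%N ->
     exists2 g, {within E, continuous g} & {in D, pds s f =1 g}).

Definition boundary D : set (plane R) := closure D `\` interior D.

(* C^k_loc(closure D \ {a}); on a compact K the suprema of the derivatives
   over K and over K `&` D are interchangeable since derivatives at boundary
   points are the continuous extensions of those in D *)
Definition cvg_Ck_closure_minus (k : nat) D (a : plane R)
    (fn : nat -> plane R -> R) f : Prop :=
  [/\ forall n, Ck_upto k (D `\ a) (closure D `\ a) (fn n),
      Ck_upto k (D `\ a) (closure D `\ a) f &
      forall K, compact K -> K `<=` closure D `\ a ->
      forall s, (size s <= k)%N ->
        {uniform K `&` D, (fun n => pds s (fn n)) @ \oo --> pds s f}].

(* C^k_loc(R^2) for functions [fn n] defined on open sets [Dn n] which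
   eventually contain every compact set *)
Definition cvg_Ck_loc_plane (k : nat) (Dn : nat -> set (plane R))
    (fn : nat -> plane R -> R) f : Prop :=
  [/\ forall n, Ck k (Dn n) (fn n),
      Ck k setT f &
      forall K, compact K ->
        (\forall n \near \oo, K `<=` Dn n) /\
        forall s, (size s <= k)%N ->
          {uniform K, (fun n => pds s (fn n)) @ \oo --> pds s f}].

End Plane.

Section Hausdorff.
Context {R : realType}.
Local Open Scope ereal_scope.
Implicit Types A : set (plane R).

Definition ediam A : \bar R :=
  maxe 0 (ereal_sup [set (enorm (z.1 - z.2))%:E | z in A `*` A]).

Definition diam_gauge (delta : R) A : \bar R :=
  if ediam A < delta%:E then ediam A else +oo.

(* one-dimensional Hausdorff outer measure; restricting the covers to Borel
   sets (as [mu_ext] does) is harmless as closures have the same diameter *)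
Definition H1 A : \bar R :=
  ereal_sup [set mu_ext (diam_gauge delta) A | delta in [set d : R | (0 < d)%R]].

Lemma ediam_ge0 A : 0 <= ediam A.
Proof. by rewrite /ediam le_max lexx. Qed.

Lemma diam_gauge_ge0 delta A : 0 <= diam_gauge delta A.
Proof. by rewrite /diam_gauge; case: ifP => // _; exact: ediam_ge0. Qed.

Lemma diam_gauge0 delta : (0 < delta)%R -> diam_gauge delta set0 = 0.
Proof.
move=> d0; rewrite /diam_gauge.
have -> : ediam set0 = 0.
  by rewrite /ediam setX0 image_set0 ereal_sup0 /maxe ltNge leNye.
by rewrite lte_fin d0.
Qed.

Lemma H1_set0 : H1 set0 = 0.
Proof.
apply/eqP; rewrite eq_le; apply/andP; split.
  apply: ge_ereal_sup => _ [d /= d0 <-].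
  by rewrite mu_ext0 //; [exact: diam_gauge0|exact: diam_gauge_ge0].
apply: le_trans (_ : mu_ext (diam_gauge 1%R) set0 <= _).
  exact: mu_ext_ge0 (diam_gauge_ge0 _) _.
by apply: ereal_sup_ubound; exists 1%R => //=.
Qed.

Lemma H1_ge0 A : 0 <= H1 A.
Proof.
apply: le_trans (_ : mu_ext (diam_gauge 1%R) A <= _).
  exact: mu_ext_ge0 (diam_gauge_ge0 _) _.
by apply: ereal_sup_ubound; exists 1%R => //=.
Qed.

Lemma le_H1 : {homo H1 : A B / A `<=` B >-> A <= B}.
Proof.
move=> A B AB; apply: ge_ereal_sup => _ [d /= d0 <-].
apply: le_trans (le_mu_ext _ AB) _.
by apply: ereal_sup_ubound; exists d.
Qed.

Lemma H1_sigma_subadditive : sigma_subadditive H1.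
Proof.
move=> F; apply: ge_ereal_sup => _ [d /= d0 <-].
apply: le_trans (mu_ext_sigma_subadditive (diam_gauge_ge0 d) F) _.
apply: lee_nneseries => [n _ _|n _].
  exact: mu_ext_ge0 (diam_gauge_ge0 _) _.
by apply: ereal_sup_ubound; exists d.
Qed.

HB.instance Definition _ := isOuterMeasure.Build R (plane R) H1
  H1_set0 H1_ge0 le_H1 H1_sigma_subadditive.

(* integral of a nonnegative function on a curve against arc length *)
Definition curve_integral (A : set (plane R)) (f : plane R -> R) : \bar R :=
  let mu : {outer_measure set (plane R) -> \bar R} := H1 in
  \int[mu : {measure set (caratheodory_type mu) -> \bar R}]_(x in A) (f x)%:E.

End Hausdorff.

Section Domain.
Context {R : realType}.
Implicit Types (Omega W : set (plane R)) (x y nu : plane R) (rho : plane R -> R).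

Definition defining_function Omega x W rho : Prop :=
  [/\ open W, W x, smooth_on W rho, (forall z, W z -> grad rho z != 0) &
      forall z, W z -> (Omega z <-> rho z < 0)].

Definition smooth_bounded_domain Omega : Prop :=
  [/\ open Omega, connected Omega, Omega !=set0, bounded_set Omega &
      forall x, boundary Omega x -> exists W rho, defining_function Omega x W rho].

Definition is_outer_normal Omega x nu : Prop :=
  exists W rho, defining_function Omega x W rho /\
    nu = (enorm (grad rho x))^-1 *: grad rho x.

Definition outer_normal Omega x : plane R :=
  xget 0 [set nu | is_outer_normal Omega x nu].

Definition inradius Omega : R :=
  sup [set rho : R | exists2 x, Omega x & disk x rho `<=` Omega].

Definition Ctilde (a : R) : R :=
  \int[leb2]_(x in disk 0 1) \int[leb2]_(y in disk 0 1)
    (enorm (x - y) `^ a)^-1.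

Definition G1 (a : R) Omega : Prop :=
  (2 * (4 - a) * pi / Ctilde a) `^ (4 - a)^-1 <= inradius Omega.

Definition G2 Omega : Prop :=
  exists y, [/\ Omega y,
    forall x, boundary Omega x -> 0 < dot (x - y) (outer_normal Omega x) &
    (curve_integral (boundary Omega)
       (fun x => (dot (x - y) (outer_normal Omega x))^-1)%R
     < (2 * pi * expR 1)%:E)%E].

Definition test_function Omega (psi : plane R -> R) : Prop :=
  smooth_on setT psi /\
  exists K, [/\ compact K, K `<=` Omega & forall x, ~ K x -> psi x = 0].

Definition Linfty_norm Omega (f : plane R -> R) : R :=
  fine ('N[leb2]_+oo [EFin \o (f \_ Omega)])%E.

End Domain.

Section Sobolev.
Context {R : realType}.
Implicit Types (Omega : set (plane R)) (v f h : plane R -> R)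
  (g : plane R -> plane R).

Definition L2 Omega f : Prop :=
  measurable_fun Omega (f : mplane -> R) /\
  leb2.-integrable Omega (EFin \o (fun x => f x ^+ 2)).

Definition L1loc Omega f : Prop :=
  measurable_fun Omega (f : mplane -> R) /\
  forall K, compact K -> K `<=` Omega -> leb2.-integrable K (EFin \o f).

Definition weak_pd Omega (i : 'I_2) v f : Prop :=
  [/\ L1loc Omega v, L1loc Omega f &
      forall psi, test_function Omega psi ->
        \int[leb2]_(x in Omega) (v x * pd i psi x) =
        - \int[leb2]_(x in Omega) (f x * psi x)].

Definition weak_grad Omega v g : Prop :=
  weak_pd Omega ord0 v (fst \o g) /\ weak_pd Omega ord_max v (snd \o g).

(* unique up to a null set when it exists, so [energy] does not depend on the
   choice *)
Definition wgrad Omega v : plane R -> plane R :=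
  xget (fun=> 0) [set g | weak_grad Omega v g].

Definition H10 Omega v : Prop :=
  [/\ L2 Omega v,
      weak_grad Omega v (wgrad Omega v),
      L2 Omega (fst \o wgrad Omega v) /\ L2 Omega (snd \o wgrad Omega v) &
      exists psi : nat -> plane R -> R,
        (forall k, test_function Omega (psi k)) /\
        \int[leb2]_(x in Omega)
          ((v x - psi k x) ^+ 2 + enorm (wgrad Omega v x - grad (psi k) x) ^+ 2)
        @[k --> \oo] --> (0 : R)].

Definition energy Omega (a p : R) v : R :=
  2^-1 * (\int[leb2]_(x in Omega) (enorm (wgrad Omega v x) ^+ 2)) -
  (2 * (p + 1))^-1 *
    (\int[leb2]_(x in Omega) \int[leb2]_(y in Omega)
       (`|v x| `^ (p + 1) * `|v y| `^ (p + 1) / enorm (x - y) `^ a)).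

(* <E_p'(v), h> = c *)
Definition energy_derivative Omega (a p : R) v h (c : R) : Prop :=
  is_derive (0 : R) (1 : R)
    (fun t : R => energy Omega a p (fun x => v x + t * h x)) c.

Definition nehari Omega (a p : R) v : Prop :=
  [/\ H10 Omega v,
      ~ {ae leb2, forall x, Omega x -> v x = 0} &
      energy_derivative Omega a p v v 0].

(* the integrand takes the junk value 0 on the null set y = x *)
Definition riesz Omega (a : R) f (x : plane R) : R :=
  \int[leb2]_(y in Omega) (f y / enorm (x - y) `^ a).

Definition solution Omega (a p : R) (u : plane R -> R) : Prop :=
  [/\ Ck 2 Omega u,
      {within closure Omega, continuous u},
      forall x, Omega x ->
        - laplacian u x = riesz Omega a (fun y => u y `^ (p + 1)) x * u x `^ p,
      forall x, Omega x -> 0 < u x &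
      forall x, boundary Omega x -> u x = 0].

Definition least_energy_solution Omega (a p : R) (u : plane R -> R) : Prop :=
  [/\ solution Omega a p u, nehari Omega a p u &
      forall v, nehari Omega a p v -> energy Omega a p u <= energy Omega a p v].

Definition eigenpair Omega (a p : R) (u : plane R -> R)
    (lam : R) (phi : plane R -> R) : Prop :=
  [/\ Ck 2 Omega phi,
      {within closure Omega, continuous phi},
      forall x, Omega x ->
        - laplacian phi x =
        lam * (p * u x `^ (p - 1) * phi x *
                 riesz Omega a (fun y => u y `^ (p + 1)) x +
               (p + 1) * u x `^ p *
                 riesz Omega a (fun y => u y `^ p * phi y) x),
      forall x, boundary Omega x -> phi x = 0 &
      Linfty_norm Omega phi = 1].

Definition first_eigenpair Omega (a p : R) (u : plane R -> R)
    (lam : R) (phi : plane R -> R) : Prop :=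
  eigenpair Omega a p u lam phi /\
  forall mu psi, eigenpair Omega a p u mu psi -> lam <= mu.

End Sobolev.

Section Green.
Context {R : realType}.
Implicit Types (Omega : set (plane R)) (G : plane R -> plane R -> R).

(* -Delta G(.,y) = delta_y in the sense of distributions on Omega *)
Definition green Omega G : Prop :=
  forall y, Omega y ->
  [/\ {within closure Omega `\ y, continuous (fun x => G x y)},
      leb2.-integrable Omega (EFin \o (fun x => G x y)),
      forall psi, test_function Omega psi ->
        \int[leb2]_(x in Omega) (G x y * - laplacian psi x) = psi y &
      forall x, boundary Omega x -> G x y = 0].

Definition regular_part G (x y : plane R) : R :=
  - (2 * pi)^-1 * ln (enorm (x - y)) - G x y.

(* H(x,x) is the value of the continuous extension of H(.,x) to x *)
Definition robin G (x : plane R) : R :=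
  lim (regular_part G z x @[z --> x^']).

End Green.

Section Concentration.
Context {R : realType}.
Implicit Types (Omega : set (plane R)) (u : R -> plane R -> R)
  (G : plane R -> plane R -> R).

Definition Calpha (a : R) : R := ((2 - a) * (4 - a) / pi) `^ (4 - a)^-1.

Definition bubble (a : R) (x : plane R) : R :=
  - ((4 - a) / 2) * ln (1 + Calpha a ^- 2 * enorm x ^+ 2).

Definition scale (a p : R) (u : plane R -> R) (x : plane R) : R :=
  (p * u x `^ (2 * p)) `^ (- (4 - a)^-1).

Definition rescaled_domain Omega (x : plane R) (eps : R) : set (plane R) :=
  [set eps^-1 *: (z - x) | z in Omega].

Definition rescaled_solution (a p : R) (u : plane R -> R) (x xi : plane R) : R :=
  p / u x * (u (scale a p u x *: xi + x) - u x).

Record concentrating_sequence Omega (a : R) u G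
    (p_ : nat -> R) (xoo : plane R) (x_ : nat -> plane R) : Prop := {
  cs_p_gt1 : forall n, 1 < p_ n ;
  cs_p_infty : p_ n @[n --> \oo] --> +oo ;
  cs_xoo : Omega xoo ;
  cs_argmax : forall n, Omega (x_ n) /\
    forall y, Omega y -> u (p_ n) y <= u (p_ n) (x_ n) ;
  cs_i_C1 : cvg_Ck_closure_minus 1 Omega xoo
    (fun n x => Num.sqrt (p_ n) * u (p_ n) x) (cst 0) ;
  cs_i_C2 : cvg_Ck_closure_minus 2 Omega xoo
    (fun n x => p_ n * u (p_ n) x)
    (fun x => 2 * (4 - a) * pi * Num.sqrt (expR 1) * G x xoo) ;
  cs_ii : p_ n * (\int[leb2]_(x in Omega) (enorm (grad (u (p_ n)) x) ^+ 2))
    @[n --> \oo] --> 2 * (4 - a) * pi * expR 1 ;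
  cs_iii : forall i, is_derive xoo (evec i) (robin G) 0 ;
  cs_iv_x : x_ n @[n --> \oo] --> xoo ;
  cs_iv_norm : forall n, u (p_ n) (x_ n) = Linfty_norm Omega (u (p_ n)) ;
  cs_iv_lim : u (p_ n) (x_ n) @[n --> \oo] --> Num.sqrt (expR 1) ;
  cs_v_eps : scale a (p_ n) (u (p_ n)) (x_ n) @[n --> \oo] --> (0 : R) ;
  cs_v_lim : cvg_Ck_loc_plane 2
    (fun n => rescaled_domain Omega (x_ n) (scale a (p_ n) (u (p_ n)) (x_ n)))
    (fun n => rescaled_solution a (p_ n) (u (p_ n)) (x_ n))
    (bubble a)
}.

End Concentration.

(* Main.v *)
Require Import Defs.
From HB Require Import structures.
From mathcomp Require Import all_boot all_order all_algebra.
From mathcomp Require Import all_classical all_reals all_analysis.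
From mathcomp Require Import measurable_realfun ess_sup_inf.
From mathcomp Require Import ring lra.

(** Write K f for the Riesz potential of f on Omega, V = u^(p-1) K(u^(p+1)) and
    L phi = p V phi + (p+1) u^p K(u^p phi). Then u itself solves
    - Delta u = (2p+1)^-1 L u, so lam <= (2p+1)^-1 by minimality. For the converse,
    Picone's inequality gives int V phi^2 <= int |grad phi|^2 = lam int phi L phi,
    while the symmetry of the kernel gives
      2 (int V phi^2 - int u^p phi K(u^p phi)) =
        int int (u(x) u(y))^(p-1) (phi(x) u(y) - u(x) phi(y))^2 / |x-y|^a >= 0.
    Together with lam <= (2p+1)^-1 these force the double integral to vanish, hence
    phi = c u, and then lam = (2p+1)^-1. The rescaled eigenfunction is therefore
    1 + v_n / p_n, which tends to 1 because v_n converges and p_n --> +oo.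

    No boundary regularity is needed in Picone's inequality: phi is replaced by the
    truncations cutF e phi and cutG e phi, which vanish where phi <= e, hence near
    the boundary, and the divergence theorem for compactly supported fields reduces
    to the fundamental theorem of calculus on lines. *)

Set Implicit Arguments.
Unset Strict Implicit.
Unset Printing Implicit Defensive.

Import Order.TTheory GRing.Theory Num.Theory.
Import numFieldNormedType.Exports.
Local Open Scope classical_set_scope.
Local Open Scope ring_scope.

(** * Borel measurability in the plane *)

Section PlaneMeasurability.
Context {R : realType}.
Implicit Types (A : set (R * R)) (x y : R * R) (f : R * R -> R).

(** Measurability in [mplane] refers to the product sigma-algebra, so an open set is exhibited as a
    countable union of squares with rational centre and radius, each a measurable rectangle. *)
Lemma open_measurable_plane A : open A -> measurable (A : set mplane).
Proof.
move=> oA.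
pose B (q : rat * rat * rat) : set (R * R) :=
  ball (ratr q.1.1 : R) (ratr q.2 : R) `*` ball (ratr q.1.2 : R) (ratr q.2 : R).
pose F (q : rat * rat * rat) : set (R * R) := if `[< B q `<=` A >] then B q else set0.
have -> : A = \bigcup_q F q.
  apply/seteqP; split => [x Ax|x [q _]]; last first.
    by rewrite /F; case: asboolP => // + Bx; apply.
  have /nbhs_ballP[e /= e0 eA] : nbhs x A by exact: open_nbhs_nbhs.
  (* With radius below [e / 2], a square that contains [x] lies in the ball of radius [e] around
     [x]. *)
  have [r] := @rat_in_itvoo R 0 (e / 2) ltac:(lra).
  rewrite in_itv/= => /andP[r0 re].
  have [q1] := @rat_in_itvoo R (x.1 - ratr r) (x.1 + ratr r) ltac:(lra).
  rewrite in_itv/= => /andP[q1l q1r].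
  have [q2] := @rat_in_itvoo R (x.2 - ratr r) (x.2 + ratr r) ltac:(lra).
  rewrite in_itv/= => /andP[q2l q2r].
  exists (q1, q2, r) => //.
  rewrite /F; case: asboolP; last first.
    case=> y [/= ]; rewrite /ball/= ; rewrite !ltr_distl => /andP[a b] /andP[c d].
    by apply: eA; split; rewrite /ball/= ltr_distlC; apply/andP; split; lra.
  by move=> _; split => /=; rewrite /ball/= ltr_distlC; apply/andP; split; lra.
apply: countable_bigcupT_measurable => // q.
rewrite /F; case: asboolP => _; last exact: measurable0.
by apply: measurableX; rewrite ball_itv; exact: measurable_itv.
Qed.

Lemma continuous_measurable_plane f :
  continuous f -> measurable_fun setT (f : mplane -> R).
Proof.
move=> /continuousP cf; apply: (measurability _ (RGenOpens.measurableE R)).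
move=> _ [_ [a [b ->] <-]]; rewrite setTI; apply: open_measurable_plane.
by apply: cf; exact: interval_open.
Qed.

End PlaneMeasurability.

(** * The Riesz kernel: positivity, measurability and a uniform integral bound *)

Section Kernel.
Context {R : realType}.
Implicit Types (x y : R * R) (Omega : set (R * R)).

Lemma enorm_ge_coord x : `|x.1| <= enorm x /\ `|x.2| <= enorm x.
Proof.
by split; rewrite /enorm /dot -sqrtr_sqr ler_sqrt ?expr2 ?lerDl ?lerDr
  ?addr_ge0// -?expr2 sqr_ge0.
Qed.

(** Balls of the product metric are squares of side [2 * r], so the product formula applies. *)
Lemma leb2_ball x (r : R) : 0 <= r -> leb2 (ball x r) = ((r *+ 2) * (r *+ 2))%:E.
Proof.
move=> r0.
have mb (t : R) : measurable (ball t r) by rewrite ball_itv; exact: measurable_itv.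
rewrite EFinM -{1}(lebesgue_measure_ball x.1 r0) -(lebesgue_measure_ball x.2 r0).
exact: (@product_measure1E _ _ _ _ R (@lebesgue_measure R) (@lebesgue_measure R)
  (ball x.1 r) (ball x.2 r) (mb _) (mb _)).
Qed.

Lemma bounded_leb2_fin Omega : bounded_set Omega ->
  measurable (Omega : set mplane) -> (leb2 Omega < +oo)%E.
Proof.
move=> [M [_ /(_ (`|M| + 1))]].
rewrite (le_lt_trans (ler_norm M)) ?ltrDl// => /(_ isT) bO mO.
apply: (@le_lt_trans _ _ (leb2 (ball (0 : R * R) (`|M| + 2)))).
  apply: le_measure; rewrite ?inE//.
    by apply: open_measurable_plane; exact: ball_open.
  move=> x Ox; rewrite -ball_normE/= sub0r normrN.
  by apply: le_lt_trans (bO _ Ox) _; rewrite ltrD2l ltr1n.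
by rewrite leb2_ball ?ltry// addr_ge0.
Qed.

Lemma leb2_sigma_finite : sigma_finite setT (@leb2 R).
Proof.
exists (fun n => ball (0 : R * R) n%:R : set mplane).
  apply/seteqP; split => // x _; exists (Num.Def.archi_bound `|x|) => //.
  by rewrite -ball_normE/= sub0r normrN; apply: archi_boundP.
move=> n; split; last by rewrite leb2_ball// ltry.
by apply: open_measurable_plane; exact: ball_open.
Qed.

(** [leb2] bundled with its sigma-finiteness, the form in which Tonelli's theorem takes it. *)
Definition sleb2 : {sigma_finite_measure set (@mplane R) -> \bar R} :=
  HB.pack (Measure.sort (@leb2 R))
    (Measure_isSigmaFinite.Build _ _ _ (@leb2 R) leb2_sigma_finite).

(** The factor under the integral in [riesz]. For nonzero [a] its value on the diagonal is the
    default [0^-1 = 0], so strict positivity holds only for [x != y]. *)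
Definition kernel (a : R) x y : R := (enorm (x - y) `^ a)^-1.

Lemma kernel_ge0 a x y : 0 <= kernel a x y.
Proof. by rewrite invr_ge0 powR_ge0. Qed.

Lemma kernelC a x y : kernel a x y = kernel a y x.
Proof.
by rewrite /kernel /enorm /dot !raddfB/=; congr ((_ `^ _)^-1); congr Num.sqrt; ring.
Qed.

Lemma kernel_gt0 a x y : x != y -> 0 < kernel a x y.
Proof.
move=> xy; rewrite invr_gt0 powR_gt0// lt_neqAle sqrtr_ge0 andbT eq_sym.
apply: contra xy => /eqP e0; have [] := enorm_ge_coord (x - y).
rewrite e0 !normr_le0 !raddfB/= !subr_eq0 => /eqP e1 /eqP e2.
by apply/eqP; case: x y e1 e2 {e0} => ? ? [? ?]/= -> ->.
Qed.

Lemma measurable_kernel a :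
  measurable_fun setT (fun z : mplane * mplane => kernel a z.1 z.2 : R).
Proof.
have -> : (fun z : @mplane R * @mplane R => kernel a z.1 z.2) =
    (fun z => powR (enorm (z.1 - z.2)) (- a)).
  by apply/funext => z; rewrite /kernel powRN.
apply: (measurableT_comp (measurable_powR (- a))).
have c1 : measurable_fun setT (fun z : @mplane R * @mplane R => z.1.1 - z.2.1).
  by apply: measurable_funB; apply: measurableT_comp.
have c2 : measurable_fun setT (fun z : @mplane R * @mplane R => z.1.2 - z.2.2).
  by apply: measurable_funB; apply: measurableT_comp.
apply: (measurableT_comp (continuous_measurable_fun (@sqrt_continuous R))).
by apply: measurable_funD; apply: measurable_funM.
Qed.

Lemma measurable_kernel1 a x : measurable_fun setT (kernel a x : mplane -> R).
Proof.
have h := measurableT_comp (measurable_kernel a) (measurable_pair1 (x : mplane)).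
exact: h.
Qed.

(* With d the sup norm of x - y, [d^-a <= 1 + 1/d] since [0 < a < 1], and 1/d is
   summed over dyadic shells. *)
Lemma kernel_dyadic a x y : 0 < a < 1 ->
  ((kernel a x y)%:E <= 1 + \sum_(0 <= k <oo)
     ((2 ^+ k.+1)%:E * (\1_(ball x (2 ^- k)) y)%:E))%E.
Proof.
move=> /andP[a0 a1].
have t0 k : (0 <= k)%N -> true ->
    (0 <= ((2 ^+ k.+1 : R)%:E * (\1_(ball x (2 ^- k)) y)%:E))%E.
  by move=> _ _; rewrite -EFinM lee_fin mulr_ge0// exprn_ge0.
have [->|xy] := eqVneq x y.
  rewrite /kernel subrr /enorm /dot/= mul0r addr0 sqrtr0 powR0 ?gt_eqF// invr0.
  by rewrite adde_ge0// nneseries_ge0.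
have k0 := kernel_gt0 a xy.
have e0 : 0 < enorm (x - y).
  rewrite lt_neqAle sqrtr_ge0 andbT; apply: contraTN k0 => /eqP e0.
  by rewrite /kernel -e0 powR0 ?gt_eqF// invr0 ltxx.
have [e1|e1] := leP 1 (enorm (x - y)).
  apply: (@le_trans _ _ 1%E); last by rewrite leeDl// nneseries_ge0.
  rewrite lee_fin invf_le1 ?powR_gt0//.
  by rewrite -[leLHS](powRr0 (enorm (x - y))) ler_powR// ltW.
pose P k := (2 : R) ^- k.+1 <= enorm (x - y).
have exP : exists k, P k.
  pose n := Num.Def.archi_bound (enorm (x - y))^-1.
  have nP : (enorm (x - y))^-1 < n%:R by apply: archi_boundP; rewrite invr_ge0 ltW.
  exists n; rewrite /P invf_ple ?posrE ?exprn_gt0//; apply: ltW (lt_le_trans nP _).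
  by rewrite -natrX ler_nat ltnW// ltnW// ltn_expl.
(* The least [k] is the index of the dyadic shell of [y]: minimality gives [enorm (x - y) < 2 ^- k],
   which for [k = 0] is the case assumption. *)
have [k Pk kmin] := ex_minnP exP.
have dk : enorm (x - y) < 2 ^- k.
  case: k Pk kmin => [|k] Pk kmin; first by rewrite expr0 invr1.
  by rewrite ltNge; apply/negP => /kmin; rewrite ltnn.
have yb : ball x (2 ^- k) y.
  by have [h1 h2] := enorm_ge_coord (x - y); split; rewrite /ball/=;
    apply: le_lt_trans dk.
apply: (@le_trans _ _ ((2 ^+ k.+1)%:E * (\1_(ball x (2 ^- k)) y)%:E)%E).
  rewrite indicE mem_set// mule1 lee_fin.
  rewrite invf_ple ?posrE ?powR_gt0 ?exprn_gt0//.
  apply: le_trans Pk _; rewrite -[leLHS]powRr1; last exact: ltW.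
  by apply: ger_powR; [rewrite e0 ltW|exact: ltW].
apply: (@le_trans _ _ (\sum_(0 <= k <oo)
     ((2 ^+ k.+1)%:E * (\1_(ball x (2 ^- k)) y)%:E))%E); last by rewrite leeDr.
apply: le_trans (nneseries_lim_ge k.+1 t0).
by rewrite big_nat_recr//= leeDr// sume_ge0// => i _; exact: t0.
Qed.

(** The bound is uniform in [x]: the k-th term of [kernel_dyadic] integrates to at most [2 ^+ k.+1]
    times the area [4 * 4 ^- k] of a square, that is [8 * 2 ^- k], and these numbers sum to 16. *)
Lemma kernel_integral_le a Omega x : 0 < a < 1 ->
  measurable (Omega : set mplane) ->
  (\int[leb2]_(y in Omega) (kernel a x y)%:E <= leb2 Omega + 16%:E)%E.
Proof.
move=> a01 mO.
pose t k (y : mplane) : \bar R := ((2 ^+ k.+1)%:E * (\1_(ball x (2 ^- k)) y)%:E)%E.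
have mb k : measurable (ball x (2 ^- k) : set mplane).
  by apply: open_measurable_plane; exact: ball_open.
have mi k : measurable_fun Omega (EFin \o (\1_(ball x (2 ^- k)) : mplane -> R)).
  apply/measurable_EFinP.
  by have h := @measurable_indic _ mplane R Omega _ (mb k); exact: h.
have mt k : measurable_fun Omega (t k).
  by have h := measurable_funeM ((2 ^+ k.+1)%:E) (mi k); exact: h.
have t0 k y : Omega y -> (0 <= t k y)%E.
  by move=> _; rewrite /t -EFinM lee_fin mulr_ge0// exprn_ge0.
have mS : measurable_fun Omega (fun y => \sum_(0 <= k <oo) t k y)%E.
  by apply: ge0_emeasurable_sum => // k y Oy _; exact: t0.
apply: (@le_trans _ _ (\int[leb2]_(y in Omega) (1 + \sum_(0 <= k <oo) t k y))%E).
  apply: ge0_le_integral => //.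
  - by move=> y _; rewrite lee_fin kernel_ge0.
  - by apply/measurable_EFinP; apply: measurable_funTS; exact: measurable_kernel1.
  - by apply: emeasurable_funD => //; exact: measurable_cst.
  - by move=> y _; exact: kernel_dyadic.
rewrite ge0_integralD//; last first.
  by move=> y Oy; apply: nneseries_ge0 => k _ _; exact: t0.
apply: leeD; first by rewrite integral_cst// mul1e.
rewrite integral_nneseries//.
have -> : 16%:E = (\sum_(0 <= k <oo) ((16 / (2 ^ (k + 1))%:R)%:E : \bar R))%E.
  apply/esym/cvg_lim => //.
  by have := @cvg_geometric_eseries_half R 16 0; rewrite expr0 divr1.
apply: lee_nneseries => [k _ _|k _]; first by apply: integral_ge0 => y /t0.
rewrite /t ge0_integralZl_EFin//.
rewrite integral_indic//.
apply: (@le_trans _ _ ((2 ^+ k.+1)%:E * leb2 (ball x (2 ^- k)))%E).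
  by rewrite lee_pmul2l ?lte_fin ?exprn_gt0//; apply: le_measure; rewrite ?inE//;
    exact: measurableI.
rewrite leb2_ball ?invr_ge0 ?exprn_ge0// -EFinM lee_fin addn1 natrX.
rewrite exprS; have : (2 : R) ^+ k != 0 by rewrite expf_neq0.
  move: ((2 : R) ^+ k) => s s0; rewrite le_eqVlt; apply/orP; left; apply/eqP.
  by field.
exact: mi.
Qed.


(** A class stable under products, sums, nonnegative powers and Riesz potentials over a set of
    finite measure, on which all integrals over such a set are finite. It concerns functions on the
    whole plane, as the zero extensions of [u] and [phi] will be. *)
Definition tame (f : R * R -> R) : Prop :=
  measurable_fun setT (f : mplane -> R) /\ exists B, forall x, 0 <= f x <= B.

Lemma tame_ge0 f x : tame f -> 0 <= f x.
Proof. by move=> [_ [B /(_ x)/andP[]]]. Qed.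

Lemma tameM f g : tame f -> tame g -> tame (fun x => f x * g x).
Proof.
move=> [mf [B fB]] [mg [C gC]]; split; first exact: measurable_funM.
exists (B * C) => x; have /andP[f0 fb] := fB x; have /andP[g0 gb] := gC x.
by rewrite mulr_ge0//= ler_pM.
Qed.

Lemma tame_powR f r : 0 <= r -> tame f -> tame (fun x => f x `^ r).
Proof.
move=> r0 [mf [B fB]]; split.
  exact: (measurableT_comp (measurable_powR r)).
exists (B `^ r) => x; have /andP[f0 fb] := fB x.
by rewrite powR_ge0 ge0_ler_powR// nnegrE (le_trans f0).
Qed.

Lemma tame_indic Omega : measurable (Omega : set mplane) -> tame (\1_Omega).
Proof.
move=> mO; split; first by have h := @measurable_indic _ mplane R setT _ mO; exact: h.
by exists 1 => x; rewrite indicE; case: (_ \in _); rewrite ?lexx ?ler01.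
Qed.

Lemma integral_indicM Omega (h : R * R -> R) :
  (\int[leb2]_(x in Omega) (h x)%:E = \int[leb2]_x (\1_Omega x * h x)%:E)%E.
Proof.
rewrite integral_mkcond; apply: eq_integral => x _; rewrite patchE indicE.
by case: (x \in Omega); rewrite ?mul1r ?mul0r.
Qed.

(** * Riesz potentials of bounded nonnegative functions *)

Section Riesz.
Variables (Omega : set (R * R)) (a : R).
Hypotheses (mO : measurable (Omega : set mplane)) (fO : (leb2 Omega < +oo)%E)
  (a01 : 0 < a < 1).

Lemma tame_integrable f : tame f -> leb2.-integrable Omega (EFin \o f).
Proof.
move=> [mf [B fB]]; have h := @measurable_bounded_integrable _ _ _ leb2 f Omega mO fO.
apply: h; first exact: measurable_funTS.
exists B; split; first exact: num_real.
move=> M BM x _ /=; have /andP[f0 fb] := fB x.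
by rewrite ger0_norm// (le_trans fb)// ltW.
Qed.

Lemma measurable_mul_kernel f x : tame f ->
  measurable_fun Omega (fun y : mplane => (f y * kernel a x y)%:E).
Proof.
move=> [mf _]; apply/measurable_EFinP; apply: measurable_funTS.
by apply: measurable_funM => //; exact: measurable_kernel1.
Qed.

Lemma integral_mul_kernel_le f B x : tame f -> (forall y, f y <= B) -> 0 <= B ->
  (\int[leb2]_(y in Omega) (f y * kernel a x y)%:E <=
   B%:E * (leb2 Omega + 16%:E))%E.
Proof.
move=> tf fB B0.
apply: (@le_trans _ _ (\int[leb2]_(y in Omega) (B%:E * (kernel a x y)%:E))%E).
  apply: ge0_le_integral => //.
  - by move=> y _; rewrite lee_fin mulr_ge0 ?kernel_ge0 ?tame_ge0.
  - exact: measurable_mul_kernel.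
  - apply: measurable_funeM; apply/measurable_EFinP; apply: measurable_funTS.
    exact: measurable_kernel1.
  - by move=> y _; rewrite lee_fin ler_wpM2r// kernel_ge0.
rewrite ge0_integralZl_EFin//; last first.
- by apply/measurable_EFinP; apply: measurable_funTS; exact: measurable_kernel1.
- by move=> y _; rewrite lee_fin kernel_ge0.
by rewrite lee_wpmul2l// ?lee_fin//; exact: kernel_integral_le.
Qed.

Lemma riesz_integrable f x : tame f ->
  leb2.-integrable Omega (EFin \o (fun y => f y * kernel a x y)).
Proof.
move=> tf; apply/integrableP; split; first exact: measurable_mul_kernel.
have [_ [B fB]] := tf.
have B0 : 0 <= B by have /andP[f0] := fB x; exact: le_trans.
apply: (@le_lt_trans _ _ (B%:E * (leb2 Omega + 16%:E))%E).
  apply: le_trans (integral_mul_kernel_le x tf _ B0).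
    apply: ge0_le_integral => //.
    - by apply: measurableT_comp => //; exact: measurable_mul_kernel.
    - exact: measurable_mul_kernel.
    - by move=> y _ /=; rewrite lee_fin ger0_norm// mulr_ge0 ?kernel_ge0 ?tame_ge0.
  by move=> y; have /andP[] := fB y.
by apply: lte_mul_pinfty; rewrite ?lee_fin//; apply: lte_add_pinfty; rewrite ?ltry.
Qed.

(** [riesz] is a real-valued integral, hence the [fine] of an extended one; integrability shows that
    no default value intervenes, so Tonelli's theorem can be used on extended integrals. *)
Lemma riesz_EFin f x : tame f ->
  ((riesz Omega a f x)%:E = \int[leb2]_(y in Omega) (f y * kernel a x y)%:E)%E.
Proof.
move=> tf; rewrite /riesz fineK//; apply: integrable_fin_num => //.
exact: riesz_integrable.
Qed.

(** Boundedness comes from the uniform bound on the integral of the kernel, measurability in [x]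
    from Tonelli's theorem. *)
Lemma tame_riesz f : tame f -> tame (riesz Omega a f).
Proof.
move=> tf; have [mf [B fB]] := tf; split; last first.
  have B0 : 0 <= B by have /andP[f0] := fB 0; exact: le_trans.
  exists (B * (fine (leb2 Omega) + 16)) => x; apply/andP; split.
    by apply: Rintegral_ge0 => y _; apply: mulr_ge0; [exact: tame_ge0|exact: kernel_ge0].
  rewrite -lee_fin riesz_EFin// EFinM EFinD fineK ?ge0_fin_numE//.
  by apply: integral_mul_kernel_le => // y; have /andP[] := fB y.
pose F (z : mplane * mplane) : \bar R := (\1_Omega z.2 * (f z.2 * kernel a z.1 z.2))%:E.
have mF : measurable_fun setT F.
  have [mI _] := tame_indic mO.
  apply/measurable_EFinP; apply: measurable_funM.
    by have h := measurableT_comp mI (@measurable_snd _ _ mplane mplane); exact: h.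
  apply: measurable_funM; last exact: measurable_kernel.
  by have h := measurableT_comp mf (@measurable_snd _ _ mplane mplane); exact: h.
have F0 z : (0 <= F z)%E.
  by rewrite lee_fin !mulr_ge0 ?kernel_ge0 ?tame_ge0//; exact: tame_indic.
have -> : (riesz Omega a f : mplane -> R) = fine \o (fun x => \int[leb2]_y F (x, y))%E.
  by apply/funext => x; rewrite /riesz/= /Rintegral integral_indicM.
apply: measurableT_comp => //.
have h := @measurable_fun_fubini_tonelli_F _ _ mplane mplane R
  sleb2 F mF F0.
exact: h.
Qed.

(* Tonelli and the symmetry of the kernel. *)
Lemma riesz_sym f g : tame f -> tame g ->
  (\int[leb2]_(x in Omega) (f x * riesz Omega a g x)%:E =
   \int[leb2]_(x in Omega) (g x * riesz Omega a f x)%:E)%E.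
Proof.
move=> tf tg.
pose F f g (z : mplane * mplane) : \bar R :=
  ((\1_Omega z.1 * f z.1) * ((\1_Omega z.2 * g z.2) * kernel a z.1 z.2))%:E.
have E h k : tame h -> tame k -> (\int[leb2]_(x in Omega) (h x * riesz Omega a k x)%:E =
    \int[leb2]_x \int[leb2]_y F h k (x, y))%E.
  move=> th tk; rewrite integral_indicM; apply: eq_integral => x _.
  rewrite mulrA EFinM riesz_EFin// integral_indicM -ge0_integralZl_EFin//.
  - by apply: eq_integral => y _; rewrite /F/= -EFinM !mulrA.
  - move=> y _; rewrite lee_fin !mulr_ge0 ?kernel_ge0 ?tame_ge0//; exact: tame_indic.
  - apply/measurable_EFinP; apply: measurable_funM; first by have [] := tame_indic mO.
    by apply: measurable_funM; [case: tk|exact: measurable_kernel1].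
  - by rewrite mulr_ge0 ?tame_ge0//; exact: tame_indic.
rewrite (E _ _ tf tg) (E _ _ tg tf).
have tF h : tame h -> tame (fun x => \1_Omega x * h x).
  by move=> th; apply: tameM => //; exact: tame_indic.
have mF h k : tame h -> tame k -> measurable_fun setT (F h k).
  move=> /tF[mh _] /tF[mk _]; apply/measurable_EFinP; apply: measurable_funM.
    by have l := measurableT_comp mh (@measurable_fst _ _ mplane mplane); exact: l.
  apply: measurable_funM; last exact: measurable_kernel.
  by have l := measurableT_comp mk (@measurable_snd _ _ mplane mplane); exact: l.
have F0 h k z : tame h -> tame k -> (0 <= F h k z)%E.
  move=> /tF th /tF tk; rewrite lee_fin; apply: mulr_ge0; first exact: (tame_ge0 z.1 th).
  by apply: mulr_ge0 (kernel_ge0 _ _ _); exact: (tame_ge0 z.2 tk).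
have h := @fubini_tonelli _ _ mplane mplane R
  sleb2 sleb2
  (F f g) (mF _ _ tf tg) (fun z => F0 _ _ z tf tg).
rewrite [LHS]h; apply: eq_integral => x _; apply: eq_integral => y _.
by rewrite /F/= kernelC; congr (_%:E); ring.
Qed.

End Riesz.
End Kernel.

(** The positive part vanishes identically, so only minus the integral of the negative part
    remains. *)
Lemma integral_le0 d (T : measurableType d) (R : realType)
    (mu : {measure set T -> \bar R}) (f : T -> \bar R) :
  (forall x, f x <= 0)%E -> (\int[mu]_x f x <= 0)%E.
Proof.
move=> f0; rewrite integralE (eq_integral (cst 0%E)); last first.
  by apply: le0_funeposE => x _.
by rewrite integral0 sub0e oppe_le0 integral_ge0.
Qed.

(** * Truncations for Picone's inequality *)

Section Cutoff.
Context {R : realType}.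
Implicit Types (e t : R).

Definition pospart e t : R := Num.max (t - e) 0.

Lemma pospart_eq0 e t : t <= e -> pospart e t = 0.
Proof. by move=> te; rewrite /pospart max_r// subr_le0. Qed.

Lemma pospart_gt e t : e <= t -> pospart e t = t - e.
Proof. by move=> te; rewrite /pospart max_l// subr_ge0. Qed.

Lemma pospart_ge0 e t : 0 <= pospart e t.
Proof. by rewrite /pospart le_max lexx orbT. Qed.

Lemma pospart_le e t : pospart e t <= `|t - e|.
Proof. by rewrite /pospart ge_max normr_ge0 ler_norm. Qed.

Lemma continuous_pospart e : continuous (pospart e).
Proof.
move=> t; apply: (@continuous_max _ _ (fun t => t - e) (cst 0)).
  by apply: cvgB; [exact: cvg_id|exact: cvg_cst].
exact: cvg_cst.
Qed.

(** The exponent is at least 2 so that the kink at [t = e] disappears. *)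
Lemma is_derive_pospart_exp n e t :
  is_derive t 1 (fun s => pospart e s ^+ n.+2) (n.+2%:R * pospart e t ^+ n.+1).
Proof.
have [te|te|->] := ltgtP t e.
- rewrite pospart_eq0 1?ltW// expr0n mulr0.
  have d0 : is_derive t 1 (cst (0 : R)) (0 : R) by exact: is_derive_cst.
  apply: near_eq_is_derive d0.
  near=> s; rewrite /cst pospart_eq0 ?expr0n//; apply: ltW; near: s; exact: lt_nbhsl.
- rewrite (pospart_gt (ltW te)).
  apply: (@near_eq_is_derive _ _ _ (fun s => (s - e) ^+ n.+2)).
    near=> s; rewrite pospart_gt//; apply: ltW; near: s; exact: lt_nbhsr.
  have d1 : is_derive t 1 (fun s => s - e) 1.
    have h := is_deriveB (is_derive_id t (1 : R)) (is_derive_cst e t 1).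
    by refine (is_derive_eq (h : is_derive t 1 (fun s => s - e) _) _); rewrite subr0.
  have d2 := @is_deriveX _ _ (fun s => s - e) n.+2 t 1 1 d1.
  rewrite exprfctE in d2.
  refine (is_derive_eq (d2 : is_derive t 1 (fun s => (s - e) ^+ n.+2) _) _).
  by rewrite -[LHS]/(_ * 1) mulr1.
(* At the kink the difference quotient is at most [|h| ^+ n.+1] in absolute value, hence at most
   [|h|] once [|h| < 1]. *)
- rewrite pospart_eq0// expr0n/= mulr0.
  have cv : (h^-1 *: (pospart e (h *: 1 + e) ^+ n.+2 - pospart e e ^+ n.+2)
      @[h --> 0^'] --> (0 : R)).
    apply/cvgr0Pnorm_lt => eps eps0; near=> h.
    have h0 : h != 0 by near: h; exact: nbhs_dnbhs_neq.
    have h1 : `|h| < Num.min 1 eps.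
      near: h; apply: dnbhs0_lt; by rewrite lt_min ltr01.
    move: h1; rewrite lt_min => /andP[h1 he].
    rewrite [pospart e e]pospart_eq0// expr0n subr0 scaler1.
    rewrite normrM normfV normrX (ger0_norm (pospart_ge0 _ _)).
    have ph : pospart e (h + e) <= `|h| by have := pospart_le e (h + e); rewrite addrK.
    rewrite mulrC ltr_pdivrMr ?normr_gt0//.
    apply: le_lt_trans (_ : `|h| * `|h| < _); last by rewrite ltr_pM2r ?normr_gt0.
    rewrite !exprS mulrA -[leRHS]mulr1 ler_pM ?mulr_ge0 ?exprn_ge0 ?pospart_ge0//.
      by rewrite ler_pM ?pospart_ge0.
    by rewrite exprn_ile1 ?pospart_ge0// (le_trans ph)// ltW.
  by split; [apply/cvg_ex; exists 0|exact: cvg_lim].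
Unshelve. all: by end_near. Qed.

(** For small [e] both [cutF e t] and [cutG e t] are close to [t], and both vanish for [t <= e].
    They are matched so that the derivative of [cutG e] is the square of that of [cutF e]: this
    completes the square in Picone's identity. *)
Definition cutF e t : R := pospart e t ^+ 2 / t.
Definition dcutF e t : R := pospart e t * (t + e) / t ^+ 2.
Definition cutG e t : R := pospart e t ^+ 3 * (3 * t + e) / (3 * t ^+ 3).

Lemma is_derive_cutF e t : 0 < t -> is_derive t 1 (cutF e) (dcutF e t).
Proof.
move=> t0; have tn0 : t != 0 by rewrite gt_eqF.
have d1 := is_derive_pospart_exp 0 e t.
have d2 : is_derive t 1 (fun s : R => s^-1) (- t ^- 2 *: 1) by apply: is_deriveV.
have h := is_deriveM d1 d2.
refine (is_derive_eq (h : is_derive t 1 (cutF e) _) _).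
have [te|te] := leP t e.
  by rewrite /dcutF pospart_eq0// expr1 !mul0r mulr0 expr0n scale0r scaler0 addr0.
by rewrite /dcutF (pospart_gt (ltW te)) /GRing.scale/=; field.
Qed.

(* [cutG] is the primitive of [dcutF ^+ 2] vanishing at e. *)
Lemma is_derive_cutG e t : 0 < t -> is_derive t 1 (cutG e) (dcutF e t ^+ 2).
Proof.
move=> t0; have tn0 : t != 0 by rewrite gt_eqF.
have d1 := is_derive_pospart_exp 1 e t.
have di : is_derive t 1 (fun s : R => s) 1 by exact: is_derive_id.
have d2 : is_derive t 1 (fun s => 3 * s + e) 3.
  have h := is_deriveD (is_deriveM (is_derive_cst (3 : R) t 1) di) (is_derive_cst e t 1).
  refine (is_derive_eq (h : is_derive t 1 (fun s => 3 * s + e) _) _).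
  rewrite /GRing.scale/=; ring.
have d3 : is_derive t 1 (fun s => 3 * s ^+ 3) (9 * t ^+ 2).
  have h := is_deriveM (is_derive_cst (3 : R) t 1) (is_deriveX 3 di).
  refine (is_derive_eq (h : is_derive t 1 (fun s => 3 * s ^+ 3) _) _).
  rewrite /GRing.scale/= /cst; ring.
have n3 : 3 * t ^+ 3 != 0 by rewrite mulf_neq0 ?expf_neq0// pnatr_eq0.
have d4 := @is_deriveV _ (fun s => 3 * s ^+ 3) _ _ _ n3 d3.
have h := is_deriveM (is_deriveM d1 d2) d4.
refine (is_derive_eq (h : is_derive t 1 (cutG e) _) _).
have [te|te] := leP t e.
  by rewrite !fctE/= /dcutF pospart_eq0// /GRing.scale/=; ring.
by rewrite !fctE/= /dcutF (pospart_gt (ltW te)) /GRing.scale/=; field.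
Qed.

Lemma cut_eq0 e t : pospart e t = 0 ->
  [/\ cutF e t = 0, dcutF e t = 0 & cutG e t = 0].
Proof. by rewrite /cutF /dcutF /cutG => ->; rewrite !expr0n/= !mul0r. Qed.

Lemma cutF_ge0 e t : 0 < t -> 0 <= cutF e t.
Proof. by move=> t0; rewrite divr_ge0 ?exprn_ge0 ?pospart_ge0// ltW. Qed.

Lemma cutG_ge0 e t : 0 < e -> 0 < t -> 0 <= cutG e t.
Proof.
by move=> e0 t0; rewrite !mulr_ge0 ?invr_ge0 ?mulr_ge0 ?exprn_ge0 ?pospart_ge0//; lra.
Qed.

Lemma cutG_le e t : 0 < e -> 0 < t -> cutG e t <= t.
Proof.
move=> e0 t0; have [te|te] := leP t e.
  by rewrite /cutG pospart_eq0// expr0n !mul0r ltW.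
rewrite /cutG (pospart_gt (ltW te)) ler_pdivrMr ?mulr_gt0 ?exprn_gt0//.
rewrite -subr_ge0.
(* A decomposition into terms that are nonnegative for [t > e]. *)
have -> : t * (3 * t ^+ 3) - (t - e) ^+ 3 * (3 * t + e) =
  8 * e * t ^+ 2 * (t - e) + 2 * (e * t) ^+ 2 + e ^+ 4 by ring.
by rewrite !addr_ge0 ?mulr_ge0 ?exprn_ge0 ?subr_ge0 ?ltW ?mulr_gt0.
Qed.

(** The loss is linear in [e], and this is the source of the error terms [4 * e] below. For
    [t <= 2 * e] the left side is nonpositive; otherwise [cutF e t >= t - 2 * e], because
    [(t - e) ^+ 2 >= t * (t - 2 * e)]. *)
Lemma cutF_sqr_ge e t : 0 < e -> 0 < t -> t ^+ 2 - 4 * e * t <= cutF e t ^+ 2.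
Proof.
move=> e0 t0; have [te|te] := leP t (2 * e).
  by apply: (@le_trans _ _ 0); [nra|rewrite sqr_ge0].
apply: (@le_trans _ _ ((t - 2 * e) ^+ 2)); first by nra.
rewrite ler_pXn2r ?nnegrE ?cutF_ge0//; last by lra.
rewrite /cutF pospart_gt; last by lra.
by rewrite ler_pdivlMr//; nra.
Qed.

Lemma continuous_dcutF e t : 0 < t -> {for t, continuous (dcutF e)}.
Proof.
move=> t0; have tn0 : t != 0 by rewrite gt_eqF.
apply: cvgM; first apply: cvgM; first exact: continuous_pospart.
  by apply: cvgD; [exact: cvg_id|exact: cvg_cst].
by apply: cvgV; [rewrite expf_neq0|exact: exprn_continuous].
Qed.

End Cutoff.

(** * Picone's inequality on a line *)

Section LinePicone.
Context {R : realType}.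
Variables (J : set R) (M e : R) (f f1 f2 g g1 g2 : R -> R).
Hypotheses (M0 : 0 < M) (e0 : 0 < e).
Hypotheses (JM : forall t, J t -> - M < t < M) (cf : continuous f)
  (f0 : forall t, ~ J t -> f t = 0)
  (fgt0 : forall t, J t -> 0 < f t) (ggt0 : forall t, J t -> 0 < g t)
  (df : forall t, J t -> is_derive t 1 f (f1 t))
  (df1 : forall t, J t -> is_derive t 1 f1 (f2 t))
  (cf2 : forall t, J t -> {for t, continuous f2})
  (dg : forall t, J t -> is_derive t 1 g (g1 t))
  (dg1 : forall t, J t -> is_derive t 1 g1 (g2 t))
  (cg2 : forall t, J t -> {for t, continuous g2}).

(** In the application [f] and [g] are the zero extensions of the eigenfunction and of the solution
    along a line, and [J] is the trace of the domain. [X] is a flux with derivative [DX]; the terms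
    of [DX] without second derivatives form a perfect square, so [h <= DX]. *)
Let h t := cutG e (f t) * f2 t - cutF e (f t) ^+ 2 / g t * g2 t.
Let X t := cutG e (f t) * f1 t - cutF e (f t) ^+ 2 / g t * g1 t.
Let DX t := h t + (dcutF e (f t) * f1 t - cutF e (f t) * g1 t / g t) ^+ 2.

(** Outside [J] continuity gives [f < e] on a whole neighbourhood, where every truncated term is
    identically zero. Smoothness across the boundary of [J] follows from this. *)
Let near_pos0 (t : R) : ~ J t -> \near t, pospart e (f t) = 0.
Proof.
move=> /f0 ft; have : f t < e by rewrite ft.
move=> fte; near=> s; apply: pospart_eq0; apply: ltW; near: s.
exact: (@cf t _ (lt_nbhsl fte)).
Unshelve. all: by end_near. Qed.

Let dX (t : R) : is_derive t 1 X (DX t).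
Proof.
have [Jt|Jt] := pselect (J t); last first.
  have DX0 : DX t = 0.
    have [|F0 dF0 G0] := @cut_eq0 _ e (f t); first by rewrite pospart_eq0// f0// ltW.
    by rewrite /DX /h F0 dF0 G0; ring.
  rewrite DX0; have d0 : is_derive t 1 (cst (0 : R)) (0 : R) by exact: is_derive_cst.
  apply: near_eq_is_derive d0.
  have := near_pos0 Jt; apply: filterS => s ps.
  by have [F0 dF0 G0] := cut_eq0 ps; rewrite /cst /X F0 G0; ring.
have gn0 : g t != 0 by rewrite gt_eqF ?ggt0.
have dGf := is_derive1_comp (is_derive_cutG e (fgt0 Jt)) (df Jt).
have dFf := is_derive1_comp (is_derive_cutF e (fgt0 Jt)) (df Jt).
have dA := is_deriveM dGf (df1 Jt).
have dB := is_deriveM (is_deriveM (is_deriveX 2 dFf) (is_deriveV gn0 (dg Jt))) (dg1 Jt).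
have d := is_deriveB dA dB.
refine (is_derive_eq (d : is_derive t 1 X _) _).
rewrite /DX /h /GRing.scale/= /comp.
by rewrite !fctE /=; field.
Qed.

Let cont_off (t : R) (k : R -> R) : ~ J t -> (forall s, pospart e (f s) = 0 -> k s = 0) ->
  {for t, continuous k}.
Proof.
move=> Jt k0; have kt : k t = 0 by apply: k0; apply: pospart_eq0; rewrite f0// ltW.
rewrite /prop_for /continuous_at kt; apply: cvg_near_cst.
by have := near_pos0 Jt; apply: filterS => s /k0.
Qed.

Let cont_of_derive (k : R -> R) (t d : R) : is_derive t 1 k d -> {for t, continuous k}.
Proof. by move=> [kd _]; apply: differentiable_continuous; exact/derivable1_diffP. Qed.

Lemma line_picone_continuous : continuous h.
Proof.
move=> t; have [Jt|Jt] := pselect (J t); last first.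
  apply: cont_off => // s ps.
  by have [F0 dF0 G0] := cut_eq0 ps; rewrite /h F0 G0; ring.
have gn0 : g t != 0 by rewrite gt_eqF ?ggt0.
have cG := cont_of_derive (is_derive1_comp (is_derive_cutG e (fgt0 Jt)) (df Jt)).
have cF := cont_of_derive (is_derive1_comp (is_derive_cutF e (fgt0 Jt)) (df Jt)).
apply: cvgB; apply: cvgM => //; first exact: cf2.
  apply: cvgM; last by apply: cvgV => //; exact: cont_of_derive (dg Jt).
  exact: (@continuous_comp _ _ _ (cutF e \o f) (fun x => x ^+ 2) t cF (@exprn_continuous _ 2 _)).
exact: cg2.
Qed.

Let cDX : continuous DX.
Proof.
move=> t; apply: cvgD; first exact: line_picone_continuous.
have [Jt|Jt] := pselect (J t); last first.
  apply: (@cont_off _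
    (fun t => (dcutF e (f t) * f1 t - cutF e (f t) * g1 t / g t) ^+ 2)) => // s ps.
  by have [F0 dF0 G0] := cut_eq0 ps; rewrite F0 dF0; ring.
have gn0 : g t != 0 by rewrite gt_eqF ?ggt0.
have cF := cont_of_derive (is_derive1_comp (is_derive_cutF e (fgt0 Jt)) (df Jt)).
have cdF : {for t, continuous (fun s => dcutF e (f s))}.
  have c := @continuous_comp _ _ _ f (dcutF e) t (@cf t) (continuous_dcutF (fgt0 Jt)).
  exact: c.
apply: (@continuous_comp _ _ _
  (fun t => dcutF e (f t) * f1 t - cutF e (f t) * g1 t / g t) (fun x => x ^+ 2));
  last exact: exprn_continuous.
apply: cvgB; apply: cvgM => //; first exact: cont_of_derive (df1 Jt).
  by apply: cvgM => //; exact: cont_of_derive (dg1 Jt).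
by apply: cvgV => //; exact: cont_of_derive (dg Jt).
Qed.

(** By the strict bounds on [J], neither [M] nor [- M] lies in [J], so [X] vanishes at both ends and
    [DX] has integral zero by the fundamental theorem of calculus; then [h <= DX] concludes. *)
Lemma line_picone : (\int[lebesgue_measure]_(t in `[(- M)%R, M]) (h t)%:E <= 0)%E.
Proof.
have MM : - M < M by rewrite gtrN.
have inth (k : R -> R) : continuous k ->
    lebesgue_measure.-integrable `[- M, M] (EFin \o k).
  move=> ck; apply: continuous_compact_integrable; first exact: segment_compact.
  exact: continuous_subspaceT.
have X0 t : ~ J t -> X t = 0.
  move=> /f0 ft; have [|F0 dF0 G0] := @cut_eq0 _ e (f t).
    by rewrite pospart_eq0// ft ltW.
  by rewrite /X F0 G0; ring.
have ih : lebesgue_measure.-integrable `[- M, M] (EFin \o h).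
  by apply: inth; exact: line_picone_continuous.
have fh : (\int[lebesgue_measure]_(t in `[(- M)%R, M]) (h t)%:E)%E \is a fin_num.
  by apply: integrable_fin_num ih; exact: measurable_itv.
rewrite -(fineK fh) lee_fin.
have -> : 0 = \int[lebesgue_measure]_(t in `[- M, M]) DX t.
  rewrite /Rintegral (@continuous_FTC2 _ _ X)//.
  - rewrite !X0; first by rewrite sube0.
    + by move=> /JM; rewrite ltxx.
    + by move=> /JM; rewrite ltxx andbF.
  - by apply: continuous_subspaceT; exact: cDX.
  - split; first by move=> t _; have [] := dX t.
    + by apply: cvg_at_right_filter; exact: cont_of_derive (dX (- M)).
    + by apply: cvg_at_left_filter; exact: cont_of_derive (dX M).
  - by move=> t _; rewrite derive1E; have [_ ->] := dX t.
apply: le_Rintegral => //; first by apply: inth; exact: cDX.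
by move=> t _; rewrite /DX lerDl sqr_ge0.
Qed.

End LinePicone.

(** * Extension by zero outside the domain *)

Section ZeroExtension.
Context {R : realType}.
Implicit Types (Omega : set (R * R)) (f : R * R -> R).

Definition zext Omega f : R * R -> R := f \_ Omega.

Lemma zext_in Omega f x : Omega x -> zext Omega f x = f x.
Proof. by move=> Ox; rewrite /zext patchE mem_set. Qed.

Lemma zext_out Omega f x : ~ Omega x -> zext Omega f x = 0.
Proof. by move=> Ox; rewrite /zext patchE memNset. Qed.

Lemma zext_near Omega f x : open Omega -> Omega x -> \near x, f x = zext Omega f x.
Proof.
move=> oO Ox; have : \near x, Omega x by exact: open_nbhs_nbhs.
by apply: filterS => y Oy; rewrite zext_in.
Qed.

Lemma closure_boundary Omega x : open Omega -> closure Omega x ->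
  Omega x \/ boundary Omega x.
Proof.
move=> oO cx; have [Ox|Ox] := pselect (Omega x); [by left|right].
by split=> // /interior_subset.
Qed.

Lemma boundary_out Omega x : open Omega -> boundary Omega x -> ~ Omega x.
Proof. by move=> oO [_ iO] Ox; apply: iO; exact: open_nbhs_nbhs. Qed.

(** At a boundary point the value is 0: nearby points of [Omega] are controlled by continuity on the
    closure, the others carry the value 0. *)
Lemma continuous_zext Omega f : open Omega ->
  {within closure Omega, continuous f} ->
  (forall x, boundary Omega x -> f x = 0) -> continuous (zext Omega f).
Proof.
move=> oO cf f0 x.
have [Ox|Ox] := pselect (closure Omega x); last first.
  have zx : zext Omega f x = 0 by rewrite zext_out// => /subset_closure.
  rewrite /continuous_at zx; apply: cvg_near_cst.
  have : \near x, (~` closure Omega) x.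
    by apply: open_nbhs_nbhs; split => //; apply: closed_openC; exact: closed_closure.
  by apply: filterS => y Oy; rewrite zext_out// => /subset_closure.
have /subspace_continuousP/(_ x Ox) fx := cf.
rewrite /continuous_at; apply/cvgrPdist_lt => eps eps0.
move/cvgrPdist_lt : fx => /(_ _ eps0); rewrite near_withinE => fx.
have [Oix|bx] := closure_boundary oO Ox.
  have On : \near x, Omega x by exact: open_nbhs_nbhs.
  apply: filterS2 fx On => y fy Oy; rewrite !zext_in//.
  by apply: fy; exact: subset_closure.
apply: filterS fx => y fy; rewrite (zext_out _ (boundary_out oO bx)).
have [Oy|Oy] := pselect (Omega y); last by rewrite zext_out// subrr normr0.
by rewrite zext_in// -(f0 _ bx); apply: fy; exact: subset_closure.
Qed.

End ZeroExtension.

(** * Restriction to lines *)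

Section LineDerivative.
Context {R : realType}.

Lemma continuous_line (v c : R * R) : continuous (fun t : R => t *: v + c).
Proof.
by move=> t; apply: cvgD; [apply: cvgZ; [exact: cvg_id|exact: cvg_cst]|exact: cvg_cst].
Qed.

Lemma is_derive_line (f : R * R -> R) (v c : R * R) (t d : R) :
  is_derive (t *: v + c) v f d -> is_derive t 1 (fun s => f (s *: v + c)) d.
Proof.
have E : (fun h : R => h^-1 *: (((fun s => f (s *: v + c)) \o shift t) (h *: 1) - f (t *: v + c)))
    = (fun h : R => h^-1 *: ((f \o shift (t *: v + c)) (h *: v) - f (t *: v + c))).
  by apply/funext => h /=; rewrite scalerDl scaler1 addrA.
by move=> [df dE]; split; [rewrite /derivable E|rewrite /derive E].
Qed.

End LineDerivative.

(** * Continuous functions vanishing outside a square *)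

Section Box.
Context {R : realType}.
Variables (M : R) (h : R * R -> R).
Hypotheses (ch : continuous h)
  (h0 : forall x, ~ (`[- M, M] `*` `[- M, M]) x -> h x = 0).

Let cB : compact (`[- M, M] `*` `[- M, M]).
Proof. by apply: compact_setX; exact: segment_compact. Qed.

Lemma continuous_box_bounded : exists C, forall x, `|h x| <= C.
Proof.
have : compact (h @` (`[- M, M] `*` `[- M, M])).
  by apply: continuous_compact => //; exact: continuous_subspaceT.
move=> /compact_bounded[C [_ /(_ (`|C| + 1))]].
rewrite (le_lt_trans (ler_norm C)) ?ltrDl// => /(_ isT) hC.
exists (`|C| + 1) => x.
have [Bx|/h0 ->] := pselect ((`[- M, M] `*` `[- M, M]) x); first by apply: hC; exists x.
by rewrite normr0 addr_ge0.
Qed.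

Lemma integrable_continuous_box : leb2.-integrable setT (EFin \o h).
Proof.
have mB : measurable (`[- M, M] `*` `[- M, M] : set (@mplane R)).
  by apply: measurableX; exact: measurable_itv.
have -> : EFin \o h = (EFin \o h) \_ (`[- M, M] `*` `[- M, M]).
  apply/funext => x; rewrite patchE; case: ifPn => // /negP nx.
  by rewrite /= h0// => Bx; apply: nx; rewrite inE.
have l := @integrable_mkcond _ (@mplane R) R leb2 _ (EFin \o h) mB.
apply/l; apply: measurable_bounded_integrable => //.
- by apply: bounded_leb2_fin => //; exact: compact_bounded.
- by apply: measurable_funTS; exact: continuous_measurable_plane.
- have [C hC] := continuous_box_bounded.
  exists C; split; first exact: num_real.
  by move=> D CD x _ /=; apply: le_trans (hC x) _; exact: ltW.
Qed.

End Box.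

(** * Picone's inequality in the plane *)

Section PlanePicone.
Context {R : realType}.
Variables (Omega : set (R * R)) (u phi : R * R -> R) (M e : R).
Hypotheses (oO : open Omega) (M0 : 0 < M) (e0 : 0 < e)
  (OM : forall x, Omega x -> - M < x.1 < M /\ - M < x.2 < M)
  (Cu : Ck 2 Omega u) (Cphi : Ck 2 Omega phi)
  (cu : {within closure Omega, continuous u})
  (cphi : {within closure Omega, continuous phi})
  (u0 : forall x, boundary Omega x -> u x = 0)
  (phi0 : forall x, boundary Omega x -> phi x = 0)
  (ugt0 : forall x, Omega x -> 0 < u x)
  (phigt0 : forall x, Omega x -> 0 < phi x).

Let P := zext Omega phi.
Let U := zext Omega u.

(** The contribution of one axis to Picone's integrand, kept separate so that it can be integrated
    along lines parallel to that axis. The second derivatives of [phi] and [u] have no meaning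
    outside [Omega], but there the truncated factors are 0. *)
Definition picone_term (i : 'I_2) (x : R * R) : R :=
  cutG e (P x) * pds [:: i; i] phi x - cutF e (P x) ^+ 2 / U x * pds [:: i; i] u x.

Let P0 x : Omega x -> 0 < P x.
Proof. by move=> Ox; rewrite /P zext_in// phigt0. Qed.

Let U0 x : Omega x -> 0 < U x.
Proof. by move=> Ox; rewrite /U zext_in// ugt0. Qed.

Let cP : continuous P. Proof. exact: continuous_zext. Qed.
Let cU : continuous U. Proof. exact: continuous_zext. Qed.

Lemma picone_term_out i x : ~ Omega x -> picone_term i x = 0.
Proof.
move=> Ox; have [|F0 _ G0] := @cut_eq0 _ e (P x).
  by rewrite pospart_eq0// /P zext_out// ltW.
by rewrite /picone_term F0 G0 expr0n/= !mul0r subrr.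
Qed.

Lemma continuous_picone_term i : continuous (picone_term i).
Proof.
move=> x; have [Ox|Ox] := pselect (Omega x).
  have cd (k : R -> R) (t d : R) : is_derive t 1 k d -> {for t, continuous k}.
    by move=> [kd _]; apply: differentiable_continuous; exact/derivable1_diffP.
  have cG := @continuous_comp _ _ _ P (cutG e) x (@cP x) (cd _ _ _ (is_derive_cutG e (P0 Ox))).
  have cF := @continuous_comp _ _ _ P (cutF e) x (@cP x) (cd _ _ _ (is_derive_cutF e (P0 Ox))).
  apply: cvgB; apply: cvgM => //; first exact: (Cphi.1 [:: i; i] x).
    apply: cvgM; last by apply: cvgV; [rewrite gt_eqF ?U0|exact: cU].
    exact: (@continuous_comp _ _ _ (cutF e \o P) (fun x => x ^+ 2) x cF (@exprn_continuous _ 2 _)).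
  exact: (Cu.1 [:: i; i] x).
rewrite /continuous_at (picone_term_out i Ox); apply: cvg_near_cst.
have Pxe : P x < e by rewrite /P zext_out.
have nP : \near x, P x < e by exact: (@cP x _ (lt_nbhsl Pxe)).
apply: filterS nP => y /ltW Pye.
have [F0 _ G0] := cut_eq0 (pospart_eq0 Pye).
by rewrite /picone_term F0 G0 expr0n/= !mul0r subrr.
Qed.

(** This is [line_picone] with [J] the preimage of [Omega] under the line; outside [[- M, M]] the
    line misses [Omega] and the term is 0. *)
Lemma line_picone_term i (c : R * R) :
  (forall t, Omega (t *: evec i + c) -> - M < t < M) ->
  (\int[lebesgue_measure]_t (picone_term i (t *: evec i + c))%:E <= 0)%E.
Proof.
move=> HM; pose L (t : R) := t *: evec i + c.
have cL : continuous L by exact: continuous_line.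
have dz f t : Ck 2 Omega f -> Omega (L t) ->
    is_derive t 1 (fun s => zext Omega f (L s)) (pd i f (L t)).
  move=> [_ Cf] Ox; apply: is_derive_line.
  apply: (near_eq_is_derive (zext_near f oO Ox)); split => //.
  exact: (Cf [::] i _ _ Ox).
have dz1 f t : Ck 2 Omega f -> Omega (L t) ->
    is_derive t 1 (fun s => pd i f (L s)) (pds [:: i; i] f (L t)).
  move=> [_ Cf] Ox; apply: is_derive_line; split => //.
  exact: (Cf [:: i] i _ _ Ox).
have cz2 f t : Ck 2 Omega f -> Omega (L t) ->
    {for t, continuous (fun s => pds [:: i; i] f (L s))}.
  move=> [Cf _] Ox.
  exact: (@continuous_comp _ _ _ L (pds [:: i; i] f) t (@cL t) (Cf [:: i; i] _ _ Ox)).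
have := @line_picone R [set t | Omega (L t)] M e (P \o L) (pd i phi \o L)
  (pds [:: i; i] phi \o L) (U \o L) (pd i u \o L) (pds [:: i; i] u \o L) M0 e0 HM.
have -> : (\int[lebesgue_measure]_t (picone_term i (t *: evec i + c))%:E =
    \int[lebesgue_measure]_(t in `[(- M)%R, M]) (picone_term i (t *: evec i + c))%:E)%E.
  rewrite [RHS]integral_mkcond; apply: eq_integral => t _; rewrite patchE.
  case: ifPn => // /negP tM; congr EFin; apply: picone_term_out => /HM /andP[t1 t2].
  by apply: tM; rewrite inE/= in_itv/= !ltW.
apply.
- by move=> t; apply: continuous_comp; [exact: cL|exact: cP].
- by move=> t Lt; rewrite /P /comp zext_out.
- by move=> t; exact: P0.
- by move=> t; exact: U0.
- by move=> t; exact: dz.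
- by move=> t; exact: dz1.
- by move=> t; exact: cz2.
- by move=> t; exact: dz.
- by move=> t; exact: dz1.
- by move=> t; exact: cz2.
Qed.


Lemma integrable_picone_term i : leb2.-integrable setT (EFin \o picone_term i).
Proof.
apply: (@integrable_continuous_box _ M); first exact: continuous_picone_term.
move=> x Bx; apply: picone_term_out => /OM[/andP[h1 h2] /andP[h3 h4]].
by apply: Bx; split; rewrite /= in_itv/= !ltW.
Qed.

(* Picone's inequality for cut-off functions, integrated along the lines parallel
   to one axis and then across them. *)
Lemma integral_picone_term i : (\int[leb2]_x (picone_term i x)%:E <= 0)%E.
Proof.
have ip := integrable_picone_term i.
(* The order of integration in Fubini's theorem is chosen so that the inner variable runs along
   [evec i]. *)
have [i0|i1] := eqVneq i ord0.
  have l := @integral21_prod_meas1 _ _ (measurableTypeR R) (measurableTypeR R) R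
    (@lebesgue_measure R) (@lebesgue_measure R) _ ip.
  apply: (@le_trans _ _ (\int[lebesgue_measure]_x
     fubini_G lebesgue_measure (EFin \o picone_term i) x)%E).
    by rewrite l.
  apply: integral_le0 => s; rewrite /fubini_G.
  have Et (t : R) : t *: evec i + (0, s : R) = (t, s : R).
    rewrite i0 /evec eqxx; apply: injective_projections => /=.
      by rewrite addr0 -[LHS]/(t * 1) mulr1.
    by rewrite scaler0 add0r.
  have H t : Omega (t *: evec i + (0, s : R)) -> - M < t < M by rewrite Et => /OM[].
  apply: le_trans (line_picone_term H); rewrite le_eqVlt; apply/orP; left; apply/eqP.
  by apply: eq_integral => t _; rewrite Et.
have l := @integral12_prod_meas1 _ _ (measurableTypeR R) (measurableTypeR R) R
  (@lebesgue_measure R) (@lebesgue_measure R) _ ip.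
apply: (@le_trans _ _ (\int[lebesgue_measure]_x
   fubini_F lebesgue_measure (EFin \o picone_term i) x)%E).
  by rewrite l.
apply: integral_le0 => s; rewrite /fubini_F.
have Et (t : R) : t *: evec i + (s : R, 0) = (s : R, t).
  rewrite /evec (negbTE i1); apply: injective_projections => /=.
    by rewrite scaler0 add0r.
  by rewrite addr0 -[LHS]/(t * 1) mulr1.
have H t : Omega (t *: evec i + (s : R, 0)) -> - M < t < M by rewrite Et => /OM[].
apply: le_trans (line_picone_term H); rewrite le_eqVlt; apply/orP; left; apply/eqP.
by apply: eq_integral => t _; rewrite Et.
Qed.


Lemma Rintegral_picone_term i : \int[leb2]_(x in Omega) picone_term i x <= 0.
Proof.
rewrite Rintegral_mkcond (_ : _ \_ _ = picone_term i); last first.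
  apply/funext => x; rewrite patchE; case: ifPn => // /negP nx.
  by rewrite picone_term_out// => Ox; apply: nx; rewrite inE.
exact/fine_le0/integral_picone_term.
Qed.

End PlanePicone.

(** * Null sets, derivatives under affine changes, and stability of [tame] *)

Section Misc.
Context {R : realType}.
Implicit Types (Omega V : set (R * R)) (f g : R * R -> R).

(** A nonempty open set contains a square of positive measure, so the exceptional null set cannot
    cover it. *)
Lemma ae_open_exists (Q : R * R -> Prop) V :
  {ae leb2, forall x, Q x} -> open V -> V !=set0 -> exists2 x, V x & Q x.
Proof.
move=> [N [mN N0 QN]] oV [x Vx]; apply: contrapT => nV.
have /nbhs_ballP[r /= r0 rV] : nbhs x V by exact: open_nbhs_nbhs.
have bN : ball x r `<=` N.
  by move=> y /rV Vy; apply: QN => /= Qy; apply: nV; exists y.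
have mb : measurable (ball x r : set mplane).
  by apply: open_measurable_plane; exact: ball_open.
have : (leb2 (ball x r : set mplane) <= leb2 N)%E by apply: le_measure; rewrite ?inE.
rewrite N0 (leb2_ball x (ltW r0)) lee_fin leNgt => /negP; apply.
by rewrite mulr_gt0// pmulrn_lgt0.
Qed.

(** [pds] differentiates total functions, so the equality is used on neighbourhoods inside the open
    set [Omega]. The constant [d] survives only at order zero. *)
Lemma Ck_affine k Omega f g (c d : R) : open Omega -> Ck k Omega f ->
  (forall x, Omega x -> g x = c * f x + d) ->
  Ck k Omega g /\ forall s x, (size s <= k)%N -> Omega x ->
    pds s g x = c * pds s f x + (if s is [::] then d else 0).
Proof.
move=> oO [Cf Df] gf.
have E s x : (size s <= k)%N -> Omega x ->
    pds s g x = c * pds s f x + (if s is [::] then d else 0).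
  elim: s x => [|i s IH] x sk Ox; first exact: gf.
  have sk' : (size s <= k)%N by rewrite ltnW.
  have nE : \near x, pds s g x = c * pds s f x + (if s is [::] then d else 0).
    have : \near x, Omega x by exact: open_nbhs_nbhs.
    by apply: filterS => y Oy; exact: IH.
  rewrite addr0 [LHS](near_eq_derive _ nE).
  have h := is_deriveD (is_deriveZ c (derivableP (Df s i x sk Ox)))
    (is_derive_cst (if s is [::] then d else 0) x (evec i)).
  have [_] := (h : is_derive x (evec i) (fun x => c * pds s f x + (if s is [::] then d else 0)) _).
  by move=> ->; rewrite addr0.
split=> //; split=> [s x sk Ox|s i x sk Ox].
  have nE : \near x, c * pds s f x + (if s is [::] then d else 0) = pds s g x.
    have : \near x, Omega x by exact: open_nbhs_nbhs.
    by apply: filterS => y Oy; rewrite E.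
  rewrite /prop_for /continuous_at E//.
  apply: cvg_trans (near_eq_cvg nE) _.
  by apply: cvgD; [apply: cvgM; [exact: cvg_cst|exact: Cf]|exact: cvg_cst].
have nE : \near x, c * pds s f x + (if s is [::] then d else 0) = pds s g x.
  have : \near x, Omega x by exact: open_nbhs_nbhs.
  by apply: filterS => y Oy; rewrite E// ltnW.
apply: (near_eq_derivable nE); apply: derivableD; last exact: derivable_cst.
have h := @derivableZ _ _ _ _ c _ _ (Df s i x sk Ox); exact: h.
Qed.

Lemma laplacian_affine Omega f g (c d : R) x : open Omega -> Ck 2 Omega f ->
  (forall x, Omega x -> g x = c * f x + d) -> Omega x ->
  laplacian g x = c * laplacian f x.
Proof.
move=> oO Cf gf Ox; have [_ E] := Ck_affine oO Cf gf.
by rewrite /laplacian mulr_sumr; apply: eq_bigr => i _; rewrite E// addr0.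
Qed.

Lemma tame_continuous_box f (M : R) : continuous f -> (forall x, 0 <= f x) ->
  (forall x, ~ (`[- M, M] `*` `[- M, M]) x -> f x = 0) -> tame f.
Proof.
move=> cf f0 fM; split; first exact: continuous_measurable_plane.
have [C hC] := continuous_box_bounded cf fM.
by exists C => x; rewrite f0/= (le_trans _ (hC x))// ler_norm.
Qed.

Lemma tameZ (c : R) f : 0 <= c -> tame f -> tame (fun x => c * f x).
Proof.
move=> c0; apply: tameM; split; first exact: measurable_cst.
by exists c => x; rewrite c0 lexx.
Qed.

Lemma tameD f g : tame f -> tame g -> tame (fun x => f x + g x).
Proof.
move=> [mf [B fB]] [mg [C gC]]; split; first exact: measurable_funD.
exists (B + C) => x; have /andP[f0 fb] := fB x; have /andP[g0 gb] := gC x.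
by rewrite addr_ge0//= lerD.
Qed.

End Misc.

(** * Linearity, definiteness and symmetry of the Riesz potential *)

Section RieszMore.
Context {R : realType}.
Variables (Omega : set (R * R)) (a : R).
Hypotheses (mO : measurable (Omega : set mplane)) (fO : (leb2 Omega < +oo)%E)
  (a01 : 0 < a < 1).

Let K := riesz Omega a.

Lemma eq_riesz f g x : (forall y, Omega y -> f y = g y) -> K f x = K g x.
Proof. by move=> fg; apply: eq_Rintegral => y; rewrite inE => /fg ->. Qed.

Lemma rieszD f g x : tame f -> tame g -> K (fun y => f y + g y) x = K f x + K g x.
Proof.
move=> tf tg; rewrite -(RintegralD mO (riesz_integrable mO fO a01 x tf)
  (riesz_integrable mO fO a01 x tg)).
by apply: eq_Rintegral => y _; rewrite mulrDl.
Qed.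

Lemma rieszZ (c : R) f x : tame f -> K (fun y => c * f y) x = c * K f x.
Proof.
move=> tf; rewrite -(RintegralZl c mO (riesz_integrable mO fO a01 x tf)).
by apply: eq_Rintegral => y _; rewrite mulrA.
Qed.

(** The integrand is nonnegative and the kernel is positive off the diagonal; [y = x] is excluded
    because of the default value there. *)
Lemma riesz_eq0 f x : tame f -> K f x = 0 ->
  {ae leb2, forall y, Omega y -> y != x -> f y = 0}.
Proof.
move=> tf Kf0; have fin := riesz_EFin mO fO a01 x tf.
have h : (\int[leb2]_(y in Omega) `|(f y * kernel a x y)%:E|)%E = 0%E.
  transitivity (K f x)%:E; last by rewrite Kf0.
  rewrite /K fin; apply: eq_integral => y _.
  by rewrite gee0_abs// lee_fin mulr_ge0 ?kernel_ge0 ?tame_ge0.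
have mk : measurable_fun Omega (fun y : mplane => (f y * kernel a x y)%:E).
  exact: measurable_mul_kernel.
have /(ae_eq_integral_abs leb2 mO mk) := h.
apply: filterS => y yE Oy yx; have /eqP := yE Oy.
by rewrite eqe mulf_eq0 (gt_eqF (kernel_gt0 _ _)) ?orbF 1?eq_sym// => /eqP.
Qed.

Lemma Rintegral_riesz_sym f g : tame f -> tame g ->
  \int[leb2]_(x in Omega) (f x * K g x) = \int[leb2]_(x in Omega) (g x * K f x).
Proof. by move=> tf tg; rewrite /Rintegral /K (riesz_sym mO fO a01 tf tg). Qed.

End RieszMore.

(** The passage to the limit [e = 0] by a single choice: if [A > B], then [e = d / (8 * (W + 1))]
    with [d = c * (A - B)] makes the error less than [d]. Using [W + 1] covers the case [W = 0]. *)
Lemma le_of_small_error (R : realType) (c A B W : R) : 0 < c -> 0 <= W ->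
  (forall e, 0 < e -> c * A <= c * B + 4 * e * W) -> A <= B.
Proof.
move=> c0 W0 H; rewrite leNgt; apply/negP => lt.
pose d := c * (A - B); have d0 : 0 < d by rewrite mulr_gt0// subr_gt0.
have W1 : 0 < 8 * (W + 1) by lra.
have := H _ (divr_gt0 d0 W1); apply/negP; rewrite -ltNge.
have -> : 4 * (d / (8 * (W + 1))) * W = d * (W / (2 * (W + 1))).
  by field; lra.
suff : d * (W / (2 * (W + 1))) < d by rewrite /d mulrBr; lra.
rewrite gtr_pMr// ltr_pdivrMr; lra.
Qed.

Lemma add_same_sub_double_le0 (R : realType) (A D : R) : A <= D -> A + A - 2 * D <= 0.
Proof. lra. Qed.

(** * Sum of the Picone terms over both axes *)

Section PiconeSum.
Context {R : realType}.
Implicit Types (f u phi : R * R -> R) (x : R * R).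

Lemma laplacianE f x :
  laplacian f x = pds [:: ord0; ord0] f x + pds [:: ord_max; ord_max] f x.
Proof.
rewrite /laplacian big_ord_recl big_ord1.
by have -> : lift ord0 ord0 = ord_max :> 'I_2 by apply/val_inj.
Qed.

Lemma picone_sum Omega u phi e x :
  picone_term Omega u phi e ord0 x + picone_term Omega u phi e ord_max x =
  cutG e (zext Omega phi x) * laplacian phi x -
  cutF e (zext Omega phi x) ^+ 2 / zext Omega u x * laplacian u x.
Proof.
rewrite !laplacianE /picone_term.
move: (pds [:: ord0; ord0] u x) (pds [:: ord_max; ord_max] u x) => A B.
move: (pds [:: ord0; ord0] phi x) (pds [:: ord_max; ord_max] phi x) => C D.
move: (cutG e _) (cutF e _ ^+ 2 / _) => G F.
ring.
Qed.

End PiconeSum.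

Local Opaque riesz laplacian pds Rintegral cutF cutG.

(** * A positive eigenfunction with eigenvalue at most [(2 * p + 1)^-1] is a multiple of [u] *)

Section Rigidity.
Context {R : realType}.
Variables (Omega : set (R * R)) (u phi : R * R -> R) (a p lam M : R).
Hypotheses (a01 : 0 < a < 1) (p1 : 1 < p) (lamle : lam <= (2 * p + 1)^-1)
  (oO : open Omega) (nO : Omega !=set0) (M0 : 0 < M)
  (OM : forall x, Omega x -> - M < x.1 < M /\ - M < x.2 < M)
  (mO : measurable (Omega : set mplane)) (fO : (leb2 Omega < +oo)%E)
  (Cu : Ck 2 Omega u) (Cphi : Ck 2 Omega phi)
  (cu : {within closure Omega, continuous u})
  (cphi : {within closure Omega, continuous phi})
  (u0 : forall x, boundary Omega x -> u x = 0)
  (phi0 : forall x, boundary Omega x -> phi x = 0)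
  (ugt0 : forall x, Omega x -> 0 < u x)
  (phigt0 : forall x, Omega x -> 0 < phi x).

Let U := zext Omega u.
Let P := zext Omega phi.
Let K := riesz Omega a.

Lemma zext_ge0 (f : R * R -> R) x : (forall x, Omega x -> 0 < f x) -> 0 <= zext Omega f x.
Proof.
move=> f0; have [Ox|Ox] := pselect (Omega x); last by rewrite zext_out.
by rewrite zext_in// ltW// f0.
Qed.

Lemma tame_zext (f : R * R -> R) : (forall x, Omega x -> 0 < f x) ->
  (forall x, boundary Omega x -> f x = 0) ->
  {within closure Omega, continuous f} -> tame (zext Omega f).
Proof.
move=> f0 fb cf; apply: (@tame_continuous_box _ _ M); first exact: continuous_zext.
  by move=> x; exact: zext_ge0.
move=> x Bx; apply: zext_out => /OM[/andP[h1 h2] /andP[h3 h4]].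
by apply: Bx; split; rewrite /= in_itv/= !ltW.
Qed.

Let tU : tame U. Proof. exact: tame_zext. Qed.
Let tP : tame P. Proof. exact: tame_zext. Qed.

Let p0 : 0 < p. Proof. exact: lt_trans ltr01 p1. Qed.

(** In the notation of the overview, [al x * K be x] is the density of the integral of V phi^2, and
    [ga x * K ga x] that of u^p phi K(u^p phi). *)
Let al x := U x `^ (p - 1) * P x ^+ 2.
Let be x := U x `^ (p + 1).
Let ga x := U x `^ p * P x.

Let tUp1 : tame (fun x => U x `^ (p - 1)).
Proof. by apply: tame_powR => //; rewrite subr_ge0 ltW. Qed.
Let tal : tame al. Proof. by apply: tameM => //; apply: tameM. Qed.
Let tbe : tame be. Proof. by apply: tame_powR => //; rewrite addr_ge0// ltW. Qed.
Let tga : tame ga. Proof. by apply: tameM => //; apply: tame_powR => //; exact: ltW. Qed.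
Let tK f : tame f -> tame (K f). Proof. by move=> tf; exact: tame_riesz. Qed.

Let U_ge0 x : 0 <= U x. Proof. exact: tame_ge0. Qed.

Let UpM x : U x * U x `^ (p - 1) = U x `^ p.
Proof. by rewrite mulr_powRB1. Qed.

Let UpMM x : U x * U x `^ p = be x.
Proof. by rewrite /be -[in LHS](addrK 1 p) mulr_powRB1// addr_gt0. Qed.

Hypotheses
  (equ : forall x, Omega x ->
     - laplacian u x = riesz Omega a (fun y => u y `^ (p + 1)) x * u x `^ p)
  (eqphi : forall x, Omega x -> - laplacian phi x =
     lam * (p * u x `^ (p - 1) * phi x * riesz Omega a (fun y => u y `^ (p + 1)) x +
            (p + 1) * u x `^ p * riesz Omega a (fun y => u y `^ p * phi y) x)).

Let equ' x : Omega x -> - laplacian u x = K be x * U x `^ p.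
Proof.
move=> Ox; rewrite (equ Ox).
have -> : U x = u x by exact: zext_in.
by rewrite (@eq_riesz _ Omega a _ be)// => y Oy; rewrite /be /U zext_in.
Qed.

Let eqphi' x : Omega x -> - laplacian phi x =
  lam * (p * U x `^ (p - 1) * P x * K be x + (p + 1) * U x `^ p * K ga x).
Proof.
move=> Ox; rewrite (eqphi Ox).
have -> : U x = u x by exact: zext_in.
have -> : P x = phi x by exact: zext_in.
rewrite (@eq_riesz _ Omega a _ be); last by move=> y Oy; rewrite /be /U zext_in.
rewrite (@eq_riesz _ Omega a (fun y => u y `^ p * phi y) ga)// => y Oy.
by rewrite /ga /U /P !zext_in.
Qed.

Let W x := U x `^ (p - 1) * P x * K be x.
Let tW : tame W. Proof. by apply: tameM; [exact: tameM|exact: tK]. Qed.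
Let talK : tame (fun x => al x * K be x). Proof. by apply: tameM => //; exact: tK. Qed.
Let tgaK : tame (fun x => ga x * K ga x). Proof. by apply: tameM => //; exact: tK. Qed.
Let tbeK : tame (fun x => be x * K al x). Proof. by apply: tameM => //; exact: tK. Qed.

Let l0 := (2 * p + 1)^-1.
Let l0_gt0 : 0 < l0. Proof. by rewrite invr_gt0 addr_gt0// mulr_gt0. Qed.
Let l0E : 1 - l0 * p = l0 * (p + 1).
Proof. by rewrite /l0; field; rewrite gt_eqF// addr_gt0// mulr_gt0. Qed.

Let T e x := l0 * (p + 1) * (al x * K be x - ga x * K ga x) - 4 * e * W x.

(** The eigenvalue term is estimated by [lam <= l0] and [cutG_le], the other by [cutF_sqr_ge]; the
    identity [1 - l0 * p = l0 * (p + 1)] gives both main terms of [T] the same coefficient. *)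
Let le_picone e x : 0 < e -> Omega x ->
  T e x <= picone_term Omega u phi e ord0 x + picone_term Omega u phi e ord_max x.
Proof.
move=> e0 Ox.
have Ux : 0 < U x by rewrite /U zext_in// ugt0.
have Px : 0 < P x by rewrite /P zext_in// phigt0.
have Kb := tame_ge0 x (tK tbe); have Kg := tame_ge0 x (tK tga).
rewrite picone_sum -/P -/U; move: (eqphi' Ox) (equ' Ox).
move: (laplacian phi x) (laplacian u x) => A B EA EB.
have -> : cutG e (P x) * A - cutF e (P x) ^+ 2 / U x * B =
    - cutG e (P x) * - A + cutF e (P x) ^+ 2 / U x * - B by ring.
rewrite EA EB.
have Ep : U x `^ p = U x * U x `^ (p - 1) by rewrite UpM.
have V0 : 0 <= U x `^ (p - 1) by exact: powR_ge0.
have -> : cutF e (P x) ^+ 2 / U x * (K be x * U x `^ p) =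
    cutF e (P x) ^+ 2 * (U x `^ (p - 1) * K be x).
  by rewrite Ep; field; rewrite gt_eqF.
set L := p * U x `^ (p - 1) * P x * K be x + (p + 1) * U x `^ p * K ga x.
have L0 : 0 <= L.
  by rewrite addr_ge0// !mulr_ge0// ?powR_ge0// ?addr_ge0// ltW.
have G0 := cutG_ge0 e0 Px.
have GP := cutG_le e0 Px.
have FP := cutF_sqr_ge e0 Px.
(* The sign of [lam] is not known at this point, so [lam] is replaced by the positive [l0] before
   [cutG] is bounded by [P x]. *)
have h1 : cutG e (P x) * (lam * L) <= P x * (l0 * L).
  apply: (@le_trans _ _ (cutG e (P x) * (l0 * L))).
    by rewrite ler_wpM2l// ler_wpM2r.
  by rewrite ler_wpM2r// mulr_ge0// ltW.
have h2 : (P x ^+ 2 - 4 * e * P x) * (U x `^ (p - 1) * K be x) <=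
    cutF e (P x) ^+ 2 * (U x `^ (p - 1) * K be x).
  by rewrite ler_wpM2r// mulr_ge0.
have -> : T e x = - (P x * (l0 * L)) + (P x ^+ 2 - 4 * e * P x) * (U x `^ (p - 1) * K be x).
  have : l0 * (p + 1) * (al x * K be x) = (1 - l0 * p) * (al x * K be x) by rewrite l0E.
  by rewrite /T /W /L /ga mulrBr => ->; rewrite /al; ring.
by rewrite mulNr lerD// lerN2.
Qed.

Let int (f : R * R -> R) := \int[leb2]_(x in Omega) f x.

Let iO f : tame f -> leb2.-integrable Omega (EFin \o f).
Proof. by move=> tf; exact: tame_integrable. Qed.

(** Both Picone terms have nonpositive integral, so integrating [le_picone] leaves only the error
    [4 * e * int W], and [e] is arbitrary. *)
Let int_le : int (fun x => al x * K be x) <= int (fun x => ga x * K ga x).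
Proof.
have lp0 : 0 < l0 * (p + 1) by rewrite mulr_gt0// addr_gt0.
have W0 : 0 <= int W by apply: Rintegral_ge0 => x _; exact: tame_ge0.
apply: (le_of_small_error lp0 W0) => e e0.
  pose q i := picone_term Omega u phi e i.
  have iq i : leb2.-integrable Omega (EFin \o q i).
    have h := @integrable_picone_term _ Omega u phi M e oO e0 OM Cu Cphi cu cphi
      u0 phi0 ugt0 phigt0 i.
    exact: integrableS h.
  have q0 i : int (q i) <= 0.
    exact: (@Rintegral_picone_term _ Omega u phi M e oO M0 e0 OM Cu Cphi cu cphi
      u0 phi0 ugt0 phigt0).
  pose c := l0 * (p + 1).
  have e40 : 0 <= 4 * e by rewrite mulr_ge0// ltW.
  pose r x := c * (ga x * K ga x) + 4 * e * W x.
  have tr : tame r by apply: tameD; [exact: tameZ (ltW lp0) _|exact: tameZ].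
  have iqq : leb2.-integrable Omega (EFin \o (fun x => q ord0 x + q ord_max x)).
    by have h := integrableD mO (iq ord0) (iq ord_max); exact: h.
  have : int (fun x => c * (al x * K be x)) <= int (fun x => (q ord0 x + q ord_max x) + r x).
    apply: le_Rintegral => //.
    - by apply: iO; exact: tameZ (ltW lp0) _.
    - by have h := integrableD mO iqq (iO tr); exact: h.
    - move=> x Ox; have := le_picone e0 Ox; rewrite /T -/c -/(q _ _) -/(q _ _) /r.
      by move: (q _ _) (q _ _) => A B; rewrite mulrBr; lra.
  have iZ k f : 0 <= k -> tame f -> leb2.-integrable Omega (EFin \o (fun x => k * f x)).
    by move=> k0 tf; apply: iO; exact: tameZ.
  have intZ k f : tame f -> int (fun x => k * f x) = k * int f.
    by move=> tf; exact: (RintegralZl k mO (iO tf)).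
  have -> : int (fun x => (q ord0 x + q ord_max x) + r x) = int (q ord0) + int (q ord_max) +
      (int (fun x => c * (ga x * K ga x)) + int (fun x => 4 * e * W x)).
    rewrite -(RintegralD mO (iq ord0) (iq ord_max)).
    rewrite -(RintegralD mO (iZ _ _ (ltW lp0) tgaK) (iZ _ _ e40 tW)).
    exact: (RintegralD mO iqq (iO tr)).
  rewrite (intZ _ _ talK) (intZ _ _ tgaK) (intZ _ _ tW) => /le_trans; apply.
  rewrite -[leRHS]add0r; apply: lerD; last by [].
  by rewrite -[leRHS]addr0; exact: lerD (q0 ord0) (q0 ord_max).
Qed.

(** The square that appears when the double integral is symmetrised. Expanding it ([nE]) also shows
    that [n x] is bounded, since [ga] is nonnegative. *)
Let n x y := U x `^ (p - 1) * U y `^ (p - 1) * (P x * U y - U x * P y) ^+ 2.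

Let nE x y : al x * be y + be x * al y = n x y + 2 * ga x * ga y.
Proof.
by rewrite /n /al /ga -!UpMM -!UpM; ring.
Qed.

Let tn x : tame (n x).
Proof.
have tb : tame (fun y => al x * be y + be x * al y).
  by apply: tameD; apply: tameZ => //; exact: tame_ge0.
have [mb [B bB]] := tb; have [mU _] := tU; have [mP _] := tP; have [mV _] := tUp1.
split.
  apply: measurable_funM; first by apply: measurable_funM => //; exact: measurable_cst.
  apply: measurable_funX; apply: measurable_funB;
    by apply: measurable_funM => //; exact: measurable_cst.
have n0 y : 0 <= n x y.
  by apply: mulr_ge0 (sqr_ge0 _); apply: mulr_ge0; exact: powR_ge0.
exists B => y; rewrite n0/=; have /andP[_] := bB y; rewrite nE; apply: le_trans; rewrite lerDl.
by apply: mulr_ge0 (tame_ge0 y tga); apply: mulr_ge0 (tame_ge0 x tga).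
Qed.

Let Kn x : al x * K be x + be x * K al x = K (n x) x + 2 * ga x * K ga x.
Proof.
have zl := @rieszZ _ _ _ mO fO a01.
have tz (c : R) (f : R * R -> R) : 0 <= c -> tame f -> tame (fun y => c * f y).
  by move=> *; exact: tameZ.
have al0 := tame_ge0 x tal; have be0 := tame_ge0 x tbe; have ga0 := tame_ge0 x tga.
have ga2 : 0 <= 2 * ga x by rewrite mulr_ge0.
have E1 := rieszD mO fO a01 x (tz _ _ al0 tbe) (tz _ _ be0 tal).
have E2 := rieszD mO fO a01 x (tn x) (tz _ _ ga2 tga).
rewrite !zl// in E1 E2; rewrite -E1 -E2.
by apply: eq_riesz => y _; exact: nE.
Qed.

(** Symmetry of the kernel makes the two mixed integrals in [Kn] equal, so this is twice the
    difference of the two sides of [int_le]. *)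
Let Kn_int : int (fun x => K (n x) x) <= 0.
Proof.
have sym : int (fun x => be x * K al x) = int (fun x => al x * K be x).
  exact: (Rintegral_riesz_sym mO fO a01 tbe tal).
have E : int (fun x => K (n x) x) =
    int (fun x => (al x * K be x + be x * K al x) - 2 * (ga x * K ga x)).
  by apply: eq_Rintegral => x _; rewrite Kn mulrA addrK.
have i1 := iO (tameD talK tbeK).
have i2 := iO (tameZ (ler0n R 2) tgaK).
have E2 : int (fun x => (al x * K be x + be x * K al x) - 2 * (ga x * K ga x)) =
    int (fun x => al x * K be x) + int (fun x => be x * K al x) - 2 * int (fun x => ga x * K ga x).
  rewrite -(RintegralD mO (iO talK) (iO tbeK)) -(RintegralZl 2 mO (iO tgaK)).
  exact: (RintegralB mO i1 i2).
by rewrite E E2 sym; exact: add_same_sub_double_le0 int_le.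
Qed.

Let Kn_ae : {ae leb2, forall x, Omega x -> K (n x) x = 0}.
Proof.
have E x : K (n x) x = (al x * K be x + be x * K al x) - 2 * (ga x * K ga x).
  by rewrite Kn mulrA addrK.
have [m1 _] := tameD talK tbeK; have [m2 _] := tameZ (ler0n R 2) tgaK.
have mk : measurable_fun Omega (fun x : mplane => (K (n x) x)%:E).
  apply/measurable_EFinP; apply: measurable_funTS.
  rewrite (_ : (fun x => K (n x) x) =
    (fun x => (al x * K be x + be x * K al x) - 2 * (ga x * K ga x))).
    exact: measurable_funB.
  by apply/funext => x; rewrite E.
have K0 x : 0 <= K (n x) x by exact: (tame_ge0 x (tK (tn x))).
have ik : leb2.-integrable Omega (fun x => (K (n x) x)%:E).
  have i1 := iO (tameD talK tbeK).
  have i2 := iO (tameZ (ler0n R 2) tgaK).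
  have h := integrableB mO i1 i2.
  by apply: eq_integrable h => // x _; rewrite /= E.
have h : (\int[leb2]_(x in Omega) `|(K (n x) x)%:E|)%E = 0%E.
  transitivity (\int[leb2]_(x in Omega) (K (n x) x)%:E)%E.
    by apply: eq_integral => x _; rewrite gee0_abs// lee_fin.
  rewrite -[LHS]fineK; last exact: integrable_fin_num ik.
  congr EFin; apply/eqP; rewrite eq_le; apply/andP; split; first exact: Kn_int.
  by apply: fine_ge0; apply: integral_ge0 => x _; rewrite lee_fin.
have /(ae_eq_integral_abs leb2 mO mk) := h.
by apply: filterS => x xE Ox; have [] := xE Ox.
Qed.

(** One base point [x0] at which [K (n x0) x0] vanishes is enough: then [n x0] vanishes almost
    everywhere in [Omega], and continuity of [r] turns this into proportionality everywhere. *)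
Lemma rigidity_proportional : exists2 c, 0 < c & forall x, Omega x -> phi x = c * u x.
Proof.
have [x0 Ox0 /(_ Ox0) Kn0] := ae_open_exists Kn_ae oO nO.
have n0 := riesz_eq0 mO fO a01 (tn x0) Kn0.
pose r y := P x0 * U y - U x0 * P y.
have cr : continuous r.
  move=> y; apply: cvgB; apply: cvgM; try exact: cvg_cst.
    by have h := continuous_zext oO cu u0; exact: h.
  by have h := continuous_zext oO cphi phi0; exact: h.
have r0 y : Omega y -> r y = 0.
  move=> Oy; apply: contrapT => ry.
  (* If [r] were nonzero at [y], it would be so on this open set, which contains a point where
     [n x0] vanishes; that point differs from [x0] because [r x0 = 0]. *)
  pose V := Omega `&` [set z | r z != 0].
  have oV : open V.
    apply: openI => //; move/continuousP : cr => /(_ [set t | t != 0]); apply.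
    exact: open_neq.
  have [z [Oz rz] nz] := ae_open_exists n0 oV (ex_intro _ y (conj Oy (introN eqP ry))).
  have zx0 : z != x0.
    by apply: contraNneq rz => ->; rewrite /r mulrC subrr.
  have /eqP := nz Oz zx0; rewrite /n mulf_eq0 mulf_eq0 sqrf_eq0 (negbTE rz) orbF.
  by rewrite !gt_eqF// powR_gt0// /U zext_in// ugt0.
have Ux0 : 0 < U x0 by rewrite /U zext_in// ugt0.
have Px0 : 0 < P x0 by rewrite /P zext_in// phigt0.
exists (P x0 / U x0); first exact: divr_gt0.
move=> y Oy; have := r0 y Oy; rewrite /r [U y]zext_in// [P y]zext_in// => /eqP.
by rewrite subr_eq0 => /eqP E; rewrite mulrAC E mulrAC divff ?mul1r// gt_eqF.
Qed.

(** With [phi = c * u] the two equations are compared at a single point; the common factor must be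
    shown nonzero before it is cancelled. *)
Lemma rigidity_eigenvalue : lam = (2 * p + 1)^-1.
Proof.
have [c c0 phiE] := rigidity_proportional.
have [x0 Ox0] := nO.
have Kb0 : K be x0 != 0.
  apply/negP => /eqP /(riesz_eq0 mO fO a01 tbe) h.
  (* Removing the vertical line through [x0] gives a nonempty open set on which [riesz_eq0] applies,
     while [be] is positive in [Omega]. *)
  pose V := Omega `&` [set z | z.1 != x0.1].
  have oV : open V.
    apply: openI => //; have c1 : continuous (fun z : R * R => z.1) by move=> z; exact: cvg_fst.
    by move/continuousP : c1 => /(_ [set t | t != x0.1]); apply; exact: open_neq.
  have nV : V !=set0.
    have /nbhs_ballP[d /= d0 dO] : nbhs x0 Omega by exact: open_nbhs_nbhs.
    exists (x0.1 + d / 2, x0.2); split; last first.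
      by rewrite /= -subr_eq0 addrAC subrr add0r gt_eqF ?divr_gt0.
    apply: dO; split; rewrite /ball/= ?subrr ?normr0//.
    by rewrite opprD addrA subrr sub0r normrN gtr0_norm ?divr_gt0// ltr_pdivrMr//; lra.
  have [z [Oz zx] bz] := ae_open_exists h oV nV.
  have : be z = 0 by apply: bz => //; apply: contra zx => /eqP ->.
  by apply/eqP; rewrite gt_eqF// /be powR_gt0// /U zext_in// ugt0.
have gaE x : Omega x -> ga x = c * be x.
  by move=> Ox; rewrite /ga -UpMM /U /P !zext_in// phiE//; ring.
have KgE : K ga x0 = c * K be x0.
  by rewrite -(rieszZ mO fO a01 c x0 tbe); apply: eq_riesz.
have Ux0 : 0 < U x0 by rewrite /U zext_in// ugt0.
have lE : laplacian phi x0 = c * laplacian u x0.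
  by apply: (laplacian_affine (d := 0) oO Cu _ Ox0) => x Ox; rewrite addr0 phiE.
have := eqphi' Ox0; rewrite lE KgE -mulrN (equ' Ox0).
have -> : P x0 = c * U x0 by rewrite /P /U !zext_in// phiE.
have Up0 : U x0 `^ p != 0 by rewrite gt_eqF// powR_gt0.
have -> : p * U x0 `^ (p - 1) * (c * U x0) * K be x0 + (p + 1) * U x0 `^ p * (c * K be x0) =
    c * (K be x0 * U x0 `^ p) * (2 * p + 1) by rewrite -UpM; ring.
move=> E; have : c * (K be x0 * U x0 `^ p) != 0 by rewrite !mulf_neq0// gt_eqF.
move: (c * _) E => t E t0; apply: (mulfI t0).
have p2 : 2 * p + 1 != 0 by rewrite gt_eqF// addr_gt0// mulr_gt0.
by apply: (mulIf p2); rewrite mulfVK// [t * lam]mulrC -mulrA -E.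
Qed.

End Rigidity.

(** * Locally uniform convergence of functions [v_n / p_n + d] *)

Section UniformConvergence.
Context {R : realType}.
Implicit Types (K Omega : set (R * R)) (fn : nat -> R * R -> R) (f : R * R -> R).

Lemma uniform_cvgP K fn f :
  {uniform K, fn @ \oo --> f} <->
  forall e, 0 < e -> \forall n \near \oo, forall y, K y -> `|f y - fn n y| < e.
Proof.
split=> [cv e e0|H P /uniform_nbhs[E [/= entE EP]]].
  apply: (cv [set h | forall y, K y -> `|f y - h y| < e]).
  apply/uniform_nbhs; exists [set xy | ball xy.1 e xy.2]; split=> //.
  exact: entourage_ball (PosNum e0).
move: entE; rewrite -entourage_ballE => -[e /= e0 eE].
have := H e e0; apply: filterS => n nK; apply: EP => y Ky.
exact: (eE (_, _) (nK y Ky)).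
Qed.

Lemma Ck_le k l Omega f : (k <= l)%N -> Ck l Omega f -> Ck k Omega f.
Proof.
move=> kl [Cf Df]; split=> [s x sk|s i x sk]; first exact/Cf/(leq_trans sk).
exact/Df/(leq_trans sk).
Qed.

(** Derivatives of [vn] are eventually bounded on each compact set, hence are killed by the factor
    [(p_ n)^-1]; only the constant [d] at order zero remains. *)
Lemma cvg_Ck_loc_plane_affine k (Dn : nat -> set (R * R)) (vn fn : nat -> R * R -> R) v
    (p_ : nat -> R) (l : nat) (d : R) :
  (k <= l)%N -> (forall n, open (Dn n)) -> p_ n @[n --> \oo] --> +oo ->
  cvg_Ck_loc_plane l Dn vn v ->
  (forall n x, Dn n x -> fn n x = (p_ n)^-1 * vn n x + d) ->
  cvg_Ck_loc_plane k Dn fn (cst d).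
Proof.
move=> kl oD pinf [Cv Cvoo cv] fE.
have A n := Ck_affine (oD n) (Ck_le kl (Cv n)) (fE n).
(* The limit is treated as [0 * v + d], which yields its derivatives in the same form as those of
   [fn n]. *)
have Aoo : Ck k setT (cst d) /\ forall s x, (size s <= k)%N -> setT x ->
    pds s (cst d) x = 0 * pds s v x + (if s is [::] then d else 0).
  by apply: Ck_affine (Ck_le kl Cvoo) _ => [|x _]; [exact: openT|rewrite mul0r add0r].
split=> [n||K cK]; [exact: (A n).1|exact: Aoo.1|].
have [KD uv] := cv K cK; split=> // s sk.
(* Tolerance 1 is enough, since only a bound [C + 1] on the derivatives of [vn] is wanted;
   [p_ n > (C + 1) / e] then gives the required smallness. *)
have /uniform_cvgP/(_ 1 ltr01) v1 := uv s (leq_trans sk kl).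
have [C [C0 vC]] : exists C, 0 < C /\ forall x, K x -> `|pds s v x| <= C.
  have : compact (pds s v @` K).
    apply: continuous_compact => //; apply: continuous_subspaceT => x.
    exact: (Cvoo.1 s x (leq_trans sk kl) I).
  move=> /compact_bounded[C [_ /(_ (`|C| + 1))]].
  rewrite (le_lt_trans (ler_norm C)) ?ltrDl// => /(_ isT) hC.
  by exists (`|C| + 1); split=> [|x Kx]; [rewrite ltr_wpDl|apply: hC; exists x].
apply/uniform_cvgP => e e0.
have C1 : 0 < (C + 1) / e by rewrite divr_gt0// addr_gt0.
have pn : \forall n \near \oo, (C + 1) / e < p_ n by have /cvgryPgt := pinf; exact.
apply: filterS3 KD v1 pn => n KDn v1 pn y Ky.
rewrite Aoo.2// (A n).2//; last exact: KDn.
have pn0 : 0 < p_ n by exact: lt_trans pn.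
rewrite mul0r add0r opprD addrCA subrr addr0 normrN normrM gtr0_norm ?invr_gt0//.
have vb : `|pds s (vn n) y| < C + 1.
  have -> : pds s (vn n) y = pds s v y - (pds s v y - pds s (vn n) y).
    by rewrite opprB addrCA subrr addr0.
  by apply: le_lt_trans (ler_normB _ _) _; apply: ler_ltD; [exact: vC|exact: v1].
rewrite mulrC ltr_pdivrMr//; apply: lt_trans vb _.
by move: pn; rewrite ltr_pdivrMr// mulrC.
Qed.

End UniformConvergence.

(** * Scaling of the essential supremum *)

Section LinftyNorm.
Context {R : realType}.
Implicit Types (Omega : set (R * R)) (f : R * R -> R).

(** For an infinite essential supremum [fine] returns 0 on both sides. *)
Lemma Linfty_normZ Omega f g (c : R) : 0 < c ->
  (forall x, Omega x -> g x = c * f x) -> Linfty_norm Omega g = c * Linfty_norm Omega f.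
Proof.
move=> c0 gf; rewrite /Linfty_norm unlock.
case: ifPn => _; last by rewrite /= mulr0.
have -> : abse \o (EFin \o g \_ Omega) = (cst c%:E \* (abse \o (EFin \o f \_ Omega)))%E.
  apply/funext => x; rewrite /= !patchE; case: ifPn; last by rewrite normr0 mule0.
  by rewrite inE => Ox; rewrite gf// normrM gtr0_norm.
rewrite ess_sup_pZl//; move: (ess_sup _ _) => [r| |] //=.
  by rewrite mulr_infty gtr0_sg// mul1e mulr0.
by rewrite mulr_infty gtr0_sg// mul1e mulr0.
Qed.

End LinftyNorm.

(** * The solution as an eigenfunction *)

Section Eigenpair.
Context {R : realType}.
Variables (Omega : set (R * R)) (u : R * R -> R) (a p M : R).
Hypotheses (a01 : 0 < a < 1) (p1 : 1 < p)
  (oO : open Omega) (M0 : 0 < M)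
  (OM : forall x, Omega x -> - M < x.1 < M /\ - M < x.2 < M)
  (mO : measurable (Omega : set mplane)) (fO : (leb2 Omega < +oo)%E)
  (su : solution Omega a p u) (N0 : 0 < Linfty_norm Omega u).

(** For [phi] a multiple of [u] the two terms of the linearized operator are [p] and [p + 1] times
    the same function. By minimality this bounds the first eigenvalue from above. *)
Lemma solution_eigenpair :
  eigenpair Omega a p u (2 * p + 1)^-1 (fun x => (Linfty_norm Omega u)^-1 * u x).
Proof.
have [Cu cu equ ugt0 u0] := su.
set c := (Linfty_norm Omega u)^-1; have c0 : 0 < c by rewrite invr_gt0.
have p0 : 0 < p by exact: lt_trans p1.
have cuE x : Omega x -> c * u x = c * u x + 0 by rewrite addr0.
split.
- by have [] := Ck_affine oO Cu cuE.
- by move=> x; apply: cvgM; [exact: cvg_cst|exact: cu].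
- move=> x Ox; rewrite (laplacian_affine oO Cu cuE Ox) -mulrN equ//.
  have ux := ugt0 x Ox.
  have be y : Omega y -> u y `^ (p + 1) = zext Omega u y `^ (p + 1).
    by move=> Oy; rewrite zext_in.
  have be' y : Omega y -> u y `^ p * (c * u y) = c * zext Omega u y `^ (p + 1).
    move=> Oy; rewrite zext_in// -[in RHS](mulr_powRB1 (ltW (ugt0 y Oy))) ?addr_gt0//.
    by rewrite addrK; ring.
  have tU : tame (fun y => zext Omega u y `^ (p + 1)).
    by apply: tame_powR; [rewrite addr_ge0// ltW|exact: tame_zext OM _ _ _ _].
  rewrite (eq_riesz a x be) (eq_riesz a x be') (rieszZ mO fO a01)//.
  rewrite -[u x `^ p](mulr_powRB1 (ltW ux))//.
  move: (riesz _ _ _ _) => k; field.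
  by rewrite gt_eqF// addr_gt0// mulr_gt0.
- by move=> x bx; rewrite u0// mulr0.
- by rewrite (Linfty_normZ c0 (f := u))// mulVf// gt_eqF.
Qed.

End Eigenpair.

(** * Bounded and rescaled domains, and the conclusion *)

Lemma bounded_box (R : realType) (Omega : set (R * R)) : bounded_set Omega ->
  exists M, 0 < M /\ forall x, Omega x -> - M < x.1 < M /\ - M < x.2 < M.
Proof.
move=> [C [_ /(_ (`|C| + 1))]].
rewrite (le_lt_trans (ler_norm C)) ?ltrDl// => /(_ isT) hC.
exists (`|C| + 2); split; first by rewrite ltr_wpDl.
move=> x /hC xC; have : ball (0 : R * R) (`|C| + 2) x.
  by rewrite -ball_normE/= sub0r normrN; apply: le_lt_trans xC _; rewrite ltrD2l ltr1n.
by move=> [h1 h2]; split; rewrite -ltr_norml;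
  [move: h1|move: h2]; rewrite /ball/= sub0r normrN.
Qed.

Lemma open_rescaled_domain (R : realType) (Omega : set (R * R)) x (e : R) :
  e != 0 -> open Omega -> open (rescaled_domain Omega x e).
Proof.
move=> e0 oO.
have -> : rescaled_domain Omega x e = (fun xi => e *: xi + x) @^-1` Omega.
  apply/seteqP; split=> [_ [z Oz <-]|xi /= Oxi].
    by rewrite /= scalerA divff// scale1r subrK.
  by exists (e *: xi + x) => //; rewrite addrK scalerA mulVf// scale1r.
have /continuousP c : continuous (fun xi : R * R => e *: xi + x); last exact: c.
by move=> xi; apply: cvgD; [apply: cvgZ; [exact: cvg_cst|exact: cvg_id]|exact: cvg_cst].
Qed.

Lemma rescaled_domain_mem (R : realType) (Omega : set (R * R)) x (e : R) xi :
  e != 0 -> rescaled_domain Omega x e xi -> Omega (e *: xi + x).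
Proof. by move=> e0 [z Oz <-]; rewrite scalerA divff// scale1r subrK. Qed.

Theorem theorem1p1 (R : realType) (a : R) (ha : 0 < a < 1)
    (Omega : set (R * R)) (hOmega : smooth_bounded_domain Omega)
    (hG1 : G1 a Omega) (hG2 : G2 Omega)
    (u : R -> R * R -> R)
    (hu : forall p : R, 1 < p -> least_energy_solution Omega a p (u p))
    (G : R * R -> R * R -> R) (hG : green Omega G)
    (p_ : nat -> R) (xoo : R * R) (x_ : nat -> R * R)
    (hconc : concentrating_sequence Omega a u G p_ xoo x_)
    (lam : nat -> R) (phi : nat -> R * R -> R)
    (hphi : forall n, first_eigenpair Omega a (p_ n) (u (p_ n)) (lam n) (phi n))
    (hpos : forall n x, Omega x -> 0 < phi n x) :
  [/\ forall n, lam n = (2 * p_ n + 1)^-1,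
      forall n x, closure Omega x ->
        phi n x = u (p_ n) x / Linfty_norm Omega (u (p_ n)) &
      let eps n := scale a (p_ n) (u (p_ n)) (x_ n) in
      cvg_Ck_loc_plane 1
        (fun n => rescaled_domain Omega (x_ n) (eps n))
        (fun n xi => phi n (x_ n + eps n *: xi) / phi n (x_ n))
        (cst 1)].
Proof.
have [oO _ nO bO _] := hOmega.
have [M [M0 OM]] := bounded_box bO.
have mO : measurable (Omega : set mplane) by exact: open_measurable_plane.
have fO := bounded_leb2_fin bO mO.
have p1 := cs_p_gt1 hconc.
have su n : solution Omega a (p_ n) (u (p_ n)) by have [] := hu _ (p1 n).
have Ox n : Omega (x_ n) by have [] := cs_argmax hconc n.
have ux0 n : 0 < u (p_ n) (x_ n) by have [_ _ _ h _] := su n; exact: h.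
(* The norm is attained at [x_ n], which is where its positivity comes from. *)
have N0 n : 0 < Linfty_norm Omega (u (p_ n)) by rewrite -(cs_iv_norm hconc).
have lamle n : lam n <= (2 * p_ n + 1)^-1.
  by have [_] := hphi n; apply; exact: (solution_eigenpair ha (p1 n) oO OM mO fO (su n) (N0 n)).
have rig n : lam n = (2 * p_ n + 1)^-1 /\
    exists2 c, 0 < c & forall x, Omega x -> phi n x = c * u (p_ n) x.
  have [Cu cu equ ugt0 u0] := su n; have [[Cphi cphi eqphi phi0 _] _] := hphi n.
  split.
    exact: (rigidity_eigenvalue ha (p1 n) (lamle n) oO nO M0 OM mO fO Cu Cphi cu cphi
      u0 phi0 ugt0 (hpos n) equ eqphi).
  exact: (rigidity_proportional ha (p1 n) (lamle n) oO nO M0 OM mO fO Cu Cphi cu cphi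
      u0 phi0 ugt0 (hpos n) equ eqphi).
have phiE n x : Omega x -> phi n x = u (p_ n) x / Linfty_norm Omega (u (p_ n)).
  move=> Oy; have [_ [c c0 phiE]] := rig n.
  have [[_ _ _ _ Nphi] _] := hphi n.
  (* The normalization of [phi n] determines the factor [c]. *)
  have cN : c * Linfty_norm Omega (u (p_ n)) = 1 by rewrite -(Linfty_normZ c0 phiE).
  have Nn0 : Linfty_norm Omega (u (p_ n)) != 0 by rewrite gt_eqF.
  by rewrite phiE// mulrC; congr (_ * _); apply: (mulIf Nn0); rewrite cN mulVf.
split=> [n|n x cx|eps]; first by have [] := rig n.
  (* On the boundary both sides are 0. *)
  have [Oy|bx] := closure_boundary oO cx; first exact: phiE.
  have [_ _ _ _ u0] := su n; have [[_ _ _ phi0 _] _] := hphi n.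
  by rewrite phi0// u0// mul0r.
have eps0 n : eps n != 0.
  by rewrite gt_eqF// powR_gt0// mulr_gt0 ?powR_gt0// (lt_trans ltr01).
(* The rescaled eigenfunction is exactly [1 + v_n / p_n]: the normalizing factors of [phi n] cancel
   in the quotient. *)
apply: (cvg_Ck_loc_plane_affine (l := 2) _ _ (cs_p_infty hconc) (cs_v_lim hconc)) => //.
  by move=> n; exact: open_rescaled_domain (eps0 n) oO.
move=> n xi /(rescaled_domain_mem (eps0 n)) Oz.
rewrite addrC phiE// phiE// /rescaled_solution -/(eps n).
have N0' := N0 n; have ux0' := ux0 n; have p0 : 0 < p_ n by rewrite (lt_trans ltr01).
by field; rewrite !gt_eqF.
Qed.
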